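(* Let $K$ be a field and let $V=V_1,\dots,V_m$ be a collection of $K$-subspaces of the space of linear forms in the polynomial ring $K[x_1,\dots,x_n]$. Let $A(V)$ be the $K$-subalgebra of $K[x_1,\dots,x_n]$ generated by the elements of the product $V_1\cdots V_m$. Then the algebra $A(V)$ is Koszul.
   Context: The product $V_1\cdots V_m$ is the $K$-vector space spanned by all products $v_1\cdots v_m$ with $v_i\in V_i$; it consists of forms of degree $m$. The algebra $A(V)$ is regarded as a standard graded $K$-algebra by giving degree $1$ to the elements of $V_1\cdots V_m$ (i.e. the usual degree is divided by $m$). A standard graded $K$-algebra is a commutative $K$-algebra $R=\bigoplus_{i\in\mathbb N}R_i$ with $R_0=K$, $\dim_K R_1<\infty$ and $R_iR_j=R_{i+j}$ for all $i,j\in\mathbb N$ (where $0\in\mathbb N$). It is Koszul if $\operatorname{Tor}_i^R(K,K)_j=0$ whenever $i\ne j$, where $K=R/\bigoplus_{i>0}R_i$; equivalently, the minimal graded free resolution of $K$ over $R$ is linear. *)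

(* Defs.v *)
From HB Require Import structures.
From mathcomp Require Import all_boot all_order all_algebra.
From mathcomp Require Import boolp.
From mathcomp Require Import mpoly.

Set Implicit Arguments.
Unset Strict Implicit.
Unset Printing Implicit Defensive.

Import GRing.Theory.
Local Open Scope ring_scope.

Definition lspan (K : fieldType) (U : lmodType K) (S : U -> Prop) (x : U) : Prop :=
  exists k (c : 'I_k -> K) (u : 'I_k -> U),
    (forall l, S (u l)) /\ x = \sum_(l < k) c l *: u l.

(* Graded K-algebras are given by a K-algebra R together with the family
   gr of its homogeneous components, gr d being R_d. *)

Section GradedAlgebras.
Variables (K : fieldType) (R : comAlgType K) (gr : nat -> R -> Prop).

Record standard_graded : Prop := StandardGraded {
  gr_submod : forall d, gr d 0 /\
    (forall (a : K) x y, gr d x -> gr d y -> gr d (a *: x + y));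
  gr_sum : forall x, exists N (u : nat -> R),
    (forall d, gr d (u d)) /\ x = \sum_(d < N) u d;
  gr_direct : forall N (u : nat -> R), (forall d, gr d (u d)) ->
    \sum_(d < N) u d = 0 -> forall d, (d < N)%N -> u d = 0;
  gr_deg0 : forall x, gr 0 x <-> exists c : K, x = c%:A;
  gr_deg1 : exists s : seq R, forall x, gr 1 x <-> lspan (fun z => z \in s) x;
  gr_mul : forall i j x, gr (i + j) x <->
    lspan (fun z => exists a b, [/\ gr i a, gr j b & z = a * b]) x
}.

(* The maximal ideal, sum of the R_d with d > 0; the residue field is its quotient. *)
Definition irrelevant : R -> Prop :=
  lspan (fun z => exists2 d, (0 < d)%N & gr d z).

Definition grz (z : int) (x : R) : Prop :=
  match z with Posz d => gr d x | Negz _ => x = 0 end.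

(* The free module R(-a_0) + ... + R(-a_(p-1)) is 'rV[R]_p together with the
   degrees a : 'I_p -> int of its basis; matrices act on the right of rows. *)
Definition homog_row p (a : 'I_p -> int) (j : int) (x : 'rV[R]_p) : Prop :=
  forall k, grz (j - a k) (x 0 k).

Definition homog_mx p q (a : 'I_p -> int) (b : 'I_q -> int) (D : 'M[R]_(p, q)) :
  Prop := forall k l, grz (a k - b l) (D k l).

(* The submodule R_+ F of F = 'rV[R]_p, so that F (x)_R K is F / R_+ F. *)
Definition irr_row p (x : 'rV[R]_p) : Prop := forall k, irrelevant (x 0 k).

Record free_complex := FreeComplex {
  rk : nat -> nat;
  shift : forall i, 'I_(rk i) -> int;
  dmap : forall i, 'M[R]_(rk i.+1, rk i);
  (* entries are representatives in R of the images of the basis in R / R_+ *)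
  augm : 'cV[R]_(rk 0)
}.

(* F is a graded free resolution of K = R / R_+, with degree 0 maps. *)
Record is_resolution (F : free_complex) : Prop := IsResolution {
  res_homog : forall i, homog_mx (@shift F i.+1) (@shift F i) (dmap F i);
  res_augm_homog : homog_mx (@shift F 0) (fun=> 0) (augm F);
  res_augm_surj : exists v : 'rV[R]_(rk F 0), irrelevant ((v *m augm F) 0 0 - 1);
  res_exact0 : forall v : 'rV[R]_(rk F 0),
    irrelevant ((v *m augm F) 0 0) <-> exists w, v = w *m dmap F 0;
  res_exact : forall i (v : 'rV[R]_(rk F i.+1)),
    v *m dmap F i = 0 <-> exists w, v = w *m dmap F i.+1
}.

(* x represents a cycle of F (x)_R K in homological degree i *)
Definition tensor_cycle (F : free_complex) (i : nat) : 'rV[R]_(rk F i) -> Prop :=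
  match i return 'rV[R]_(rk F i) -> Prop with
  | 0 => fun _ => True
  | i'.+1 => fun x => irr_row (x *m dmap F i')
  end.

(* H_i(F (x)_R K)_j = 0 *)
Definition homology_eq0 (F : free_complex) (i : nat) (j : int) : Prop :=
  forall x : 'rV[R]_(rk F i), homog_row (@shift F i) j x -> tensor_cycle x ->
  exists2 y : 'rV[R]_(rk F i.+1),
    homog_row (@shift F i.+1) j y & irr_row (x - y *m dmap F i).

(* Tor_i^R(K, K)_j = 0.  Tor may be computed from any graded free resolution;
   R being Noetherian, those with terms of finite rank suffice, and the first
   conjunct states that there is one. *)
Definition Tor_eq0 (i : nat) (j : int) : Prop :=
  (exists F, is_resolution F) /\
  (forall F, is_resolution F -> homology_eq0 F i j).

Definition Koszul : Prop :=
  standard_graded /\ forall (i : nat) (j : int), i%:Z <> j -> Tor_eq0 i j.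

End GradedAlgebras.

Inductive gen_subalg (K : fieldType) (P : comAlgType K) (S : P -> Prop) : P -> Prop :=
| gen_scalar c : gen_subalg S c%:A
| gen_mem x : S x -> gen_subalg S x
| gen_add x y : gen_subalg S x -> gen_subalg S y -> gen_subalg S (x + y)
| gen_mul x y : gen_subalg S x -> gen_subalg S y -> gen_subalg S (x * y).

Section ProductAlgebra.
Variables (K : fieldType) (n m : nat) (V : 'I_m -> submodClosed {mpoly K[n]}).

Definition prod_space : {mpoly K[n]} -> Prop :=
  lspan (fun f => exists2 v : 'I_m -> {mpoly K[n]},
    (forall i, v i \in V i) & f = \prod_(i < m) v i).

Definition prod_alg_pred : {pred {mpoly K[n]}} :=
  fun f => `[< gen_subalg prod_space f >].

Lemma prod_alg_subalg_closed : subalg_closed prod_alg_pred.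
Proof.
have P f : (f \in prod_alg_pred) = `[< gen_subalg prod_space f >] by [].
split=> [|a x y|x y]; rewrite !P.
- by apply/asboolP; rewrite -(scale1r 1); exact: gen_scalar.
- move=> /asboolP hx /asboolP hy; apply/asboolP; apply: gen_add => //.
  by rewrite -mulr_algl; apply: gen_mul => //; exact: gen_scalar.
- by move=> /asboolP hx /asboolP hy; apply/asboolP; exact: gen_mul.
Qed.

HB.instance Definition _ :=
  GRing.isSubalgClosed.Build K {mpoly K[n]} prod_alg_pred prod_alg_subalg_closed.

Record prod_alg := ProdAlg {
  prod_alg_val :> {mpoly K[n]};
  _ : prod_alg_val \in prod_alg_pred
}.

HB.instance Definition _ := [isSub for prod_alg_val].
HB.instance Definition _ := [Choice of prod_alg by <:].
HB.instance Definition _ := [SubChoice_isSubComNzRing of prod_alg by <:].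
HB.instance Definition _ := [SubZmodule_isSubLmodule of prod_alg by <:].
HB.instance Definition _ := [SubNzRing_SubLmodule_isSubLalgebra of prod_alg by <:].
HB.instance Definition _ := [SubLalgebra_isSubAlgebra of prod_alg by <:].

(* The usual degree divided by m, so that V_1...V_m is in degree 1. *)
Definition prod_alg_gr (d : nat) (f : prod_alg) : Prop :=
  prod_alg_val f \is (m * d)%N.-homog.

End ProductAlgebra.

(* Main.v *)
From HB Require Import structures.
Require Import Defs.
From mathcomp Require Import all_boot all_order all_algebra.
From mathcomp Require Import boolp.
From mathcomp Require Import mpoly.

(* Write V^a = V_1^{a_1}...V_m^{a_m} for a in N^m, P_A for the ideal generated by
   the V_i with i in A, and M_a for the A(V)-module with components
   V^{a + (d,...,d)}, so that M_0 = A(V).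

   Over an infinite field, V^a is the degree |a| part of the intersection over A
   of the powers P_A^{a(A)}, a(A) being the sum of the a_i with i in A: one inducts
   by restricting to the hyperplane z = 0 for a generic z in V_l, a_l > 0.  Hence
   V^a \cap (z) = z V^{a-e_l}, and the same holds modulo (W_k), where
   W_0 < W_1 < ... is a generic flag in V_l.

   Let F be a linear resolution of K over A(V), built up to degree i.  Then the
   homology of F (x) M in degree i is linear for all M = M_a / (W_k), by induction
   on i and a.  If a_l > 0 one uses
     0 -> M_{a-e_l}/(W_k) -> M_a/(W_k) -> M_a/(W_{k+1}) -> 0
   and descends from W_k = V_l; if a_l = 0 one uses 0 -> N -> M_a -> M_a/(W_k) -> 0,
   where the positive part of N = M_a \cap (W_k) is filtered with quotients
   M_{a+(1,...,1)-e_l}/(W_j), j < k.  For M_(1,...,1), which is the shifted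
   irrelevant ideal, this says that the kernel of the last differential is
   generated in degree 1, so that F can be continued linearly.  A finite K is
   handled by descent from K(t). *)

Set Implicit Arguments.
Unset Strict Implicit.
Unset Printing Implicit Defensive.

Import GRing.Theory.
Local Open Scope ring_scope.

(** * Linear forms and powers of linear ideals *)

Section LinearForms.
Variables (K : fieldType) (n : nat).
Implicit Types (u v z : 'rV[K]_n) (g h p : {mpoly K[n]}) (R S : 'M[K]_n).

Lemma mpoly_gen_ind (P : {mpoly K[n]} -> Prop) :
  (forall c, P c%:MP) -> (forall i, P 'X_i) ->
  (forall g h, P g -> P h -> P (g + h)) ->
  (forall g h, P g -> P h -> P (g * h)) -> forall g, P g.
Proof.
move=> PC PX PD PM; elim/mpolyind; first by rewrite -mpolyC0.
move=> c m p _ _ Pp; apply: (PD) => //; rewrite -mul_mpolyC; apply: (PM) => //.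
rewrite [m]multinomUE_id -mprodXnE.
apply: big_ind => [|g h|i _]; [by rewrite -mpolyC1 | exact: (PM) |].
elim: (m i) => [|k IHk]; first by rewrite expr0 -mpolyC1.
by rewrite exprS; apply: (PM).
Qed.

Definition lform u : {mpoly K[n]} := \sum_j u 0 j *: 'X_j.

Fact lform_is_linear : linear lform.
Proof.
move=> a u v; rewrite /lform scaler_sumr -big_split; apply: eq_bigr => j _ /=.
by rewrite !mxE scalerDl scalerA.
Qed.
HB.instance Definition _ :=
  GRing.isLinear.Build K 'rV[K]_n {mpoly K[n]} *:%R lform lform_is_linear.

Lemma lformZ a u : lform (a *: u) = a *: lform u.
Proof. exact: linearZ. Qed.

Lemma lformD u v : lform (u + v) = lform u + lform v.
Proof. exact: linearD. Qed.

Lemma lformB u v : lform (u - v) = lform u - lform v.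
Proof. exact: linearB. Qed.

Lemma lform_sum I (r : seq I) (f : I -> 'rV[K]_n) :
  lform (\sum_(i <- r) f i) = \sum_(i <- r) lform (f i).
Proof. exact: raddf_sum. Qed.

Lemma lform_coef u j : (lform u)@_U_(j) = u 0 j.
Proof.
rewrite raddf_sum (bigD1 j) //= mcoeffZ mcoeffXU eqxx mulr1 big1 ?addr0 // => i ij.
by rewrite mcoeffZ mcoeffXU (negPf ij) mulr0.
Qed.

Lemma lform_eq0 u : (lform u == 0) = (u == 0).
Proof.
apply/eqP/eqP => [u0|->]; last by rewrite raddf0.
by apply/rowP => j; rewrite -lform_coef u0 mcoeff0 mxE.
Qed.

Lemma lform_homog u : lform u \is 1.-homog.
Proof. by apply: rpred_sum => j _; apply: rpredZ; rewrite dhomogX /= mdeg1. Qed.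

Lemma homog1_lform g : g \is 1.-homog -> g = lform (\row_j g@_U_(j)).
Proof.
move=> hg; apply/mpolyP => m.
have [/mdeg1P[i /eqP->]|m1] := boolP (mdeg m == 1%N).
  by rewrite lform_coef mxE.
by rewrite (dhomog_nemf_coeff hg m1) (dhomog_nemf_coeff (lform_homog _) m1).
Qed.

Lemma pihomogMl e d g h : g \is e.-homog ->
  pihomog mdeg (e + d) (g * h) = g * pihomog mdeg d h.
Proof.
move=> hg; elim/mpolyind: h => [|c m h _ _ IH]; first by rewrite mulr0 !linear0 mulr0.
rewrite mulrDr !pihomogD mulrDr IH; congr (_ + _).
rewrite -scalerAr !linearZ /= -scalerAr; congr (_ *: _).
rewrite pihomogX; case: eqP => [md|/eqP md].
  by apply: pihomog_dE; rewrite dhomogM // dhomogX md.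
rewrite mulr0; apply: (@pihomog_ne0 _ _ _ (e + mdeg m)); first by rewrite eqn_add2l.
by rewrite dhomogM // dhomogX.
Qed.

Lemma homog_quotient e d g h : g \is e.-homog -> g * h \is (e + d).-homog ->
  exists2 h', g * h = g * h' & h' \is d.-homog.
Proof.
move=> hg hgh; exists (pihomog mdeg d h); last exact: pihomogP.
by rewrite -(pihomogMl _ _ hg) pihomog_dE.
Qed.

Local Notation lsubst R := (comp_mpoly [tuple lform (row j R) | j < n]).

Lemma lsubst_lform R u : lsubst R (lform u) = lform (u *m R).
Proof.
rewrite raddf_sum mulmx_sum_row raddf_sum; apply: eq_bigr => j _ /=.
by rewrite comp_mpolyZ comp_mpolyXU -tnth_nth tnth_mktuple linearZ.
Qed.

Lemma lformX j : 'X_j = lform (delta_mx 0 j).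
Proof.
rewrite [RHS](bigD1 j) //= big1 => [|i ij]; first by rewrite mxE !eqxx scale1r addr0.
by rewrite mxE eqxx (negPf ij) scale0r.
Qed.

Lemma lsubst_comp R S g : lsubst S (lsubst R g) = lsubst (R *m S) g.
Proof.
elim/mpoly_gen_ind: g => [c|j|g h Hg Hh|g h Hg Hh].
- by rewrite !comp_mpolyC.
- by rewrite lformX !lsubst_lform mulmxA.
- by rewrite !rmorphD /= Hg Hh.
- by rewrite !rmorphM /= Hg Hh.
Qed.

Lemma lsubst1 g : lsubst 1%:M g = g.
Proof.
elim/mpoly_gen_ind: g => [c|j|g h Hg Hh|g h Hg Hh].
- by rewrite comp_mpolyC.
- by rewrite lformX lsubst_lform mulmx1.
- by rewrite rmorphD /= Hg Hh.
- by rewrite rmorphM /= Hg Hh.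
Qed.

Lemma homog_prod_expn (I : Type) (r : seq I) (m : I -> nat) (f : I -> {mpoly K[n]}) :
  (forall i, f i \is 1.-homog) ->
  \prod_(i <- r) f i ^+ m i \is (\sum_(i <- r) m i).-homog.
Proof.
move=> hf; elim: r => [|i r IH]; first by rewrite !big_nil dhomog1.
rewrite !big_cons; apply: dhomogM => //.
by have := dhomogMn (m i) (hf i); rewrite mul1n.
Qed.

Lemma lsubst_homog d R g : g \is d.-homog -> lsubst R g \is d.-homog.
Proof.
move=> /dhomogP hg; rewrite comp_mpolyEX big_seq; apply: rpred_sum => m /hg md.
apply: rpredZ; rewrite comp_mpolyX -md /= mdegE; apply: homog_prod_expn => i.
by rewrite tnth_mktuple lform_homog.
Qed.

(** A variable x_t with [z 0 t != 0] is eliminated: [S] sends x_t to x_t - z / z_t and fixes the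
    other variables. It kills z, and every polynomial is congruent to its image modulo z. *)
Lemma lform_elimination z : z != 0 -> exists S : 'M[K]_n,
  z *m S = 0 /\ (forall g, lsubst S g = 0 -> exists h, g = lform z * h).
Proof.
move=> z0; have [t zt] : exists t, z 0 t != 0.
  apply/existsP; rewrite -negb_forall; apply: contra z0 => /forallP z0.
  by apply/eqP/rowP => t; rewrite mxE; apply/eqP.
pose c : 'cV[K]_n := (z 0 t)^-1 *: delta_mx t 0.
have cE u : u *m c = ((z 0 t)^-1 * u 0 t)%:M.
  apply/rowP => i; rewrite !ord1 mxE (bigD1 t) //= big1 => [|j jt].
    by rewrite !mxE !eqxx mulr1 addr0 mulrC mulr1n.
  by rewrite !mxE (negPf jt) mulr0 mulr0.
exists (1%:M - c *m z); split.
  by rewrite mulmxBr mulmx1 mulmxA cE mulVf // mul1mx subrr.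
suff W g : exists h, g - lsubst (1%:M - c *m z) g = lform z * h.
  by move=> g g0; have [h] := W g; rewrite g0 subr0; exists h.
elim/mpoly_gen_ind: g => [a|j|g1 g2 [h1 H1] [h2 H2]|g1 g2 [h1 H1] [h2 H2]].
- by exists 0; rewrite comp_mpolyC subrr mulr0.
- exists (((z 0 t)^-1 * (delta_mx 0 j : 'rV_n) 0 t)%:MP).
  rewrite lformX lsubst_lform -lformB mulmxBr mulmx1 subKr mulmxA cE.
  by rewrite mul_scalar_mx /= lformZ -mul_mpolyC mulrC.
- by exists (h1 + h2); rewrite rmorphD opprD addrACA H1 H2 mulrDr.
- exists (h1 * g2 + lsubst (1%:M - c *m z) g1 * h2).
  by rewrite mulrDr mulrA -H1 mulrCA -H2 mulrBl mulrBr addrA subrK rmorphM.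
Qed.

Inductive ideal_pow (U : 'M[K]_n) : nat -> {mpoly K[n]} -> Prop :=
| ideal_pow_top g : ideal_pow U 0 g
| ideal_pow_zero c : ideal_pow U c 0
| ideal_pow_add c g h : ideal_pow U c g -> ideal_pow U c h -> ideal_pow U c (g + h)
| ideal_pow_mul c u g : (u <= U)%MS -> ideal_pow U c g ->
    ideal_pow U c.+1 (lform u * g).

Lemma ideal_powM U c d g h :
  ideal_pow U c g -> ideal_pow U d h -> ideal_pow U (c + d) (g * h).
Proof.
have absorb e p q : ideal_pow U e p -> ideal_pow U e (q * p).
  elim=> {e p} [p|e|e p1 p2 _ H1 _ H2|e u p uU _ H].
  - exact: ideal_pow_top.
  - by rewrite mulr0; apply: ideal_pow_zero.
  - by rewrite mulrDr; apply: ideal_pow_add.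
  - by rewrite mulrCA; apply: ideal_pow_mul.
move=> Hg Hh; elim: Hg => {c g} [g|e|e p1 p2 _ H1 _ H2|e u p uU _ H].
- by rewrite add0n; apply: absorb.
- by rewrite mul0r; apply: ideal_pow_zero.
- by rewrite mulrDl; apply: ideal_pow_add.
- by rewrite -mulrA addSn; apply: ideal_pow_mul.
Qed.

Lemma ideal_powS U c g : ideal_pow U c.+1 g -> ideal_pow U c g.
Proof.
move Ec: c.+1 => c' Hg; elim: Hg c Ec => {c' g} //.
- by move=> c' c _; apply: ideal_pow_zero.
- by move=> c' p1 p2 _ H1 _ H2 c Ec; apply: ideal_pow_add; [apply: H1|apply: H2].
- move=> c' u p uU Hp H [|c] [Ec]; first exact: ideal_pow_top.
  by rewrite -Ec in H *; apply: ideal_pow_mul => //; apply: H.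
Qed.

Lemma ideal_pow_leq U c d g : (c <= d)%N -> ideal_pow U d g -> ideal_pow U c g.
Proof.
by move/subnK <-; elim: (d - c)%N => // k IH; rewrite addSn => /ideal_powS.
Qed.

Lemma ideal_pow_submx U W c g : (U <= W)%MS -> ideal_pow U c g -> ideal_pow W c g.
Proof.
move=> UW; elim=> {c g} [g|c|c g h _ H1 _ H2|c u g uU _ H].
- exact: ideal_pow_top.
- exact: ideal_pow_zero.
- exact: ideal_pow_add.
- by apply: ideal_pow_mul => //; apply: submx_trans UW.
Qed.

Lemma ideal_pow_subst U S c g :
  ideal_pow U c g -> ideal_pow (U *m S) c (lsubst S g).
Proof.
elim=> {c g} [g|c|c g h _ H1 _ H2|c u g uU _ H].
- exact: ideal_pow_top.
- by rewrite raddf0; apply: ideal_pow_zero.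
- by rewrite rmorphD; apply: ideal_pow_add.
- by rewrite rmorphM /= lsubst_lform; apply: ideal_pow_mul => //; apply: submxMr.
Qed.

(** * Order of vanishing along a linear subspace *)

Section Blowup.
Variables (P : idomainType) (f : {rmorphism {mpoly K[n]} -> P}).
Hypothesis f_inj : injective f.

(* Spreads out the order of vanishing along the zero set of U: the forms in U
   are multiplied by the new variable, those of a complement are unchanged. *)
Definition blowup (U : 'M[K]_n) : {mpoly K[n]} -> {poly P} :=
  mmap (polyC \o f \o @mpolyC n K)
    (fun j => (f (lform (row j (proj_mx U^C%MS U))))%:P
              + (f (lform (row j (proj_mx U U^C%MS))))%:P * 'X).

Lemma blowupD U g h : blowup U (g + h) = blowup U g + blowup U h.
Proof. exact: mmapD. Qed.

Lemma blowup0 U : blowup U 0 = 0.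
Proof. exact: mmap0. Qed.

Lemma blowupM U g h : blowup U (g * h) = blowup U g * blowup U h.
Proof. exact: rmorphM. Qed.

Lemma blowupC U c : blowup U c%:MP = (f c%:MP)%:P.
Proof. exact: mmapC. Qed.

Lemma blowup_lform U u :
  blowup U (lform u) = (f (lform (u *m proj_mx U^C%MS U)))%:P
                       + (f (lform (u *m proj_mx U U^C%MS)))%:P * 'X.
Proof.
rewrite !mulmx_sum_row !lform_sum {1}/lform.
rewrite [blowup U _]raddf_sum !raddf_sum mulr_suml -big_split.
apply: eq_bigr => j _ /=.
rewrite /blowup mmapZ mmapX mmap1U /= mulrDr.
by rewrite !lformZ -!mul_mpolyC !rmorphM mulrA.
Qed.

Lemma compl_proj_mx U u :
  u *m proj_mx U^C%MS U + u *m proj_mx U U^C%MS = u :> 'rV[K]_n.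
Proof.
rewrite addrC add_proj_mx ?capmx_compl //.
exact/submx_full/addsmx_compl_full.
Qed.

Lemma blowup_sub U u : (u <= U)%MS -> blowup U (lform u) = (f (lform u))%:P * 'X.
Proof.
move=> uU; rewrite blowup_lform.
rewrite (proj_mx_id (capmx_compl U) uU) proj_mx_0 ?raddf0 ?add0r //.
by rewrite capmxC capmx_compl.
Qed.

(** Setting the new variable to 1 puts the two components of each linear form back together. *)
Lemma blowup_sum U g : (blowup U g).[1] = f g.
Proof.
elim/mpoly_gen_ind: g => [c|j|g h Hg Hh|g h Hg Hh].
- by rewrite blowupC hornerC.
- rewrite lformX blowup_lform hornerD hornerMX !hornerC mulr1 -rmorphD -lformD.
  by rewrite compl_proj_mx.
- by rewrite blowupD hornerD Hg Hh rmorphD.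
- by rewrite blowupM hornerM Hg Hh rmorphM.
Qed.

(** Forwards, each factor from [U] contributes a factor of the new variable. Backwards, the
    coefficient of degree e always comes from the e-th power of the ideal, and g is recovered as the
    sum of the coefficients, of which only those of degree at least c survive. *)
Lemma ideal_pow_blowup U c g :
  ideal_pow U c g <-> forall e, (e < c)%N -> (blowup U g)`_e = 0.
Proof.
split.
  elim=> {c g} [//|c e _|c g h _ H1 _ H2 e ec|c u g uU _ H e].
  - by rewrite blowup0 coef0.
  - by rewrite blowupD coefD H1 ?H2 ?addr0.
  - rewrite ltnS blowupM blowup_sub // -mulrA coefCM mulrC coefXM.
    by case: e => [|e] ec /=; rewrite ?mul0r // H ?mul0r.
pose Q e x := exists2 p, ideal_pow U e p & x = f p.
have Q0 e : Q e 0 by exists 0; [exact: ideal_pow_zero | rewrite rmorph0].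
have QD e x y : Q e x -> Q e y -> Q e (x + y).
  move=> [p Hp ->] [q Hq ->]; exists (p + q); first exact: ideal_pow_add.
  by rewrite rmorphD.
have T p e : Q e (blowup U p)`_e.
  elim/mpoly_gen_ind: p e => [a|j|p q Hp Hq|p q Hp Hq] e.
  - rewrite blowupC coefC; case: e => [|e]; last exact: Q0.
    by exists a%:MP; first exact: ideal_pow_top.
  - rewrite lformX blowup_lform coefD coefMX !coefC.
    case: e => [|[|e]] /=; last by rewrite addr0; apply: Q0.
      by rewrite addr0; eexists; first exact: ideal_pow_top.
    rewrite add0r; eexists; last by [].
    rewrite -[X in ideal_pow _ _ X]mulr1; apply: ideal_pow_mul.
      exact: proj_mx_sub.
    exact: ideal_pow_top.
  - by rewrite blowupD coefD; apply: QD.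
  - rewrite blowupM coefM; apply: (big_ind (Q e)); [exact: Q0|exact: QD|].
    move=> i _; have [p' Hp' ->] := Hp i; have [q' Hq' ->] := Hq (e - i)%N.
    exists (p' * q'); last by rewrite rmorphM.
    rewrite -[X in ideal_pow _ X](subnKC (ltn_ord i : i <= e)%N).
    exact: ideal_powM.
move=> H; suff [p Hp /f_inj ->] : Q c (f g) by [].
rewrite -(blowup_sum U g) horner_coef.
apply: (big_ind (Q c)); [exact: Q0|exact: QD|].
move=> i _; rewrite expr1n mulr1; have [ic|ci] := ltnP i c.
  by rewrite H.
by have [p Hp ->] := T g i; exists p; first exact: ideal_pow_leq Hp.
Qed.

(** The blowup of z has a non-zero constant coefficient, its component in the complement of [U].
    Multiplication by it does not raise the order in a domain, so the low coefficients for g vanish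
    one after the other. *)
Lemma ideal_pow_colon_notin_aux U c z g : ~~ (z <= U)%MS ->
  ideal_pow U c (lform z * g) -> ideal_pow U c g.
Proof.
move=> zU /ideal_pow_blowup H; apply/ideal_pow_blowup => e.
have z0 : (blowup U (lform z))`_0 != 0.
  rewrite blowup_lform coefD coefMX addr0 coefC /= -(rmorph0 f) (inj_eq f_inj).
  rewrite lform_eq0; apply: contra zU => /eqP z0.
  by rewrite -(compl_proj_mx U z) z0 add0r proj_mx_sub.
elim/ltn_ind: e => e IH ec; have := H e ec.
rewrite blowupM coefM big_ord_recl subn0 big1 => [/eqP|i _].
  by rewrite addr0 mulf_eq0 (negPf z0) /= => /eqP.
have ie : (e - lift ord0 i < e)%N by rewrite lift0 ltn_subrL (leq_trans _ (ltn_ord i)).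
by rewrite IH ?mulr0 // (ltn_trans ie).
Qed.

(** Here the blowup of z is a non-zero constant times the new variable, so it raises the order by
    exactly one. *)
Lemma ideal_pow_colon_in_aux U c z g : (z <= U)%MS -> z != 0 ->
  ideal_pow U c.+1 (lform z * g) -> ideal_pow U c g.
Proof.
move=> zU z0 /ideal_pow_blowup H; apply/ideal_pow_blowup => e ec.
have := H e.+1 ec; rewrite blowupM blowup_sub // -mulrA coefCM mulrC coefXM /=.
move/eqP; rewrite mulf_eq0 -[X in _ || (_ == X)](rmorph0 f) (inj_eq f_inj).
by rewrite lform_eq0 (negPf z0) orbF => /eqP.
Qed.

End Blowup.

Lemma ideal_pow_colon_notin U c z g : ~~ (z <= U)%MS ->
  ideal_pow U c (lform z * g) -> ideal_pow U c g.
Proof. exact: (ideal_pow_colon_notin_aux (f := idfun)). Qed.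

Lemma ideal_pow_colon_in U c z g : (z <= U)%MS -> z != 0 ->
  ideal_pow U c.+1 (lform z * g) -> ideal_pow U c g.
Proof. exact: (ideal_pow_colon_in_aux (f := idfun)). Qed.

End LinearForms.
Notation lsubst R := (comp_mpoly [tuple lform (row j R) | j < _]).

(** * Products of linear spaces as intersections *)

Section ProductSpaces.
Variables (K : fieldType) (n m : nat).
Implicit Types (u z : 'rV[K]_n) (g h : {mpoly K[n]}) (R S W : 'M[K]_n).
Implicit Types (V : 'I_m -> 'M[K]_n) (a b : 'X_{1..m}) (A : {set 'I_m}).

(** The space V^a, with the exponent vector kept as a multi-index and each V_i given as the row
    space of a matrix. *)
Inductive pspace V : 'X_{1..m} -> {mpoly K[n]} -> Prop :=
| pspace_zero a : pspace V a 0
| pspace_const c : pspace V 0%MM c%:MP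
| pspace_add a g h : pspace V a g -> pspace V a h -> pspace V a (g + h)
| pspace_mul a i u g : (u <= V i)%MS -> pspace V a g ->
    pspace V (U_(i) + a)%MM (lform u * g).

Lemma pspaceM V a b g h :
  pspace V a g -> pspace V b h -> pspace V (a + b)%MM (g * h).
Proof.
move=> Hg Hh; elim: Hg => {a g} [a|c|a g1 g2 _ H1 _ H2|a i u g uV _ H].
- by rewrite mul0r; apply: pspace_zero.
- rewrite add0m mul_mpolyC; elim: Hh => {b h} [b|d|b g h _ Hg _ Hh|b i u g uV _ H].
  + by rewrite scaler0; apply: pspace_zero.
  + by rewrite -mul_mpolyC -mpolyCM; apply: pspace_const.
  + by rewrite scalerDr; apply: pspace_add.
  + by rewrite scalerAr; apply: pspace_mul.
- by rewrite mulrDl; apply: pspace_add.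
- by rewrite -mulrA -addmA; apply: pspace_mul.
Qed.

Lemma pspaceZ V a c g : pspace V a g -> pspace V a (c *: g).
Proof.
move=> Hg; rewrite -mul_mpolyC -[a]add0m; apply: pspaceM => //.
exact: pspace_const.
Qed.

Lemma pspaceB V a g h : pspace V a g -> pspace V a h -> pspace V a (g - h).
Proof. by move=> Hg Hh; rewrite -scaleN1r; apply/pspace_add/pspaceZ. Qed.

Lemma pspace_sum V a I (r : seq I) (f : I -> {mpoly K[n]}) :
  (forall i, pspace V a (f i)) -> pspace V a (\sum_(i <- r) f i).
Proof.
move=> Hf; apply: (big_ind (pspace V a)) => // [|g h]; first exact: pspace_zero.
exact: pspace_add.
Qed.

Lemma pspace_homog V a g : pspace V a g -> g \is (mdeg a).-homog.
Proof.
elim=> {a g} [a|c|a g h _ Hg _ Hh|a i u g _ _ H].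
- exact: dhomog0.
- by rewrite -alg_mpolyC mdeg0 rpredZ // dhomog1.
- exact: dhomogD.
- by rewrite mdegD mdeg1 dhomogM // lform_homog.
Qed.

Lemma pspace_subst V S a g :
  pspace V a g -> pspace (fun i => V i *m S) a (lsubst S g).
Proof.
elim=> {a g} [a|c|a g h _ Hg _ Hh|a i u g uV _ H].
- by rewrite raddf0; apply: pspace_zero.
- by rewrite comp_mpolyC; apply: pspace_const.
- by rewrite rmorphD; apply: pspace_add.
- by rewrite rmorphM /= lsubst_lform; apply: pspace_mul => //; apply: submxMr.
Qed.

(** A linear form in the image of V_i lifts to V_i, so elements of the restricted product space lift
    factor by factor. *)
Lemma pspace_subst_lift V S a h : pspace (fun i => V i *m S) a h ->
  exists2 g, pspace V a g & h = lsubst S g.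
Proof.
elim=> {a h} [a|c|a g h _ [g' Hg ->] _ [h' Hh ->]|a i u g uV _ [g' Hg ->]].
- by exists 0; rewrite ?raddf0 //; apply: pspace_zero.
- by exists c%:MP; rewrite ?comp_mpolyC //; apply: pspace_const.
- by exists (g' + h'); rewrite ?rmorphD //; apply: pspace_add.
- have [w def_u] := submxP uV; exists (lform (w *m V i) * g').
    by apply: pspace_mul => //; apply: submxMl.
  by rewrite rmorphM /= lsubst_lform -mulmxA -def_u.
Qed.

(** The easy inclusion of the intersection theorem: each factor from V_i with i in A lies in P_A. *)
Lemma pspace_ideal_pow V a g A : pspace V a g ->
  ideal_pow (\sum_(i in A) V i)%MS (\sum_(i in A) a i) g.
Proof.
elim=> {a g} [a|c|a g h _ Hg _ Hh|a i u g uV _ H].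
- exact: ideal_pow_zero.
- rewrite [X in ideal_pow _ X]big1 => [|i _]; last by rewrite mnm0E.
  exact: ideal_pow_top.
- exact: ideal_pow_add.
- have -> : (\sum_(j in A) (U_(i) + a)%MM j = (i \in A) + \sum_(j in A) a j)%N.
    rewrite (eq_bigr (fun j => (i == j) + a j)%N) => [|j _]; last first.
      by rewrite mnmDE mnm1E.
    rewrite big_split; congr (_ + _)%N; have [iA|iA] := boolP (i \in A).
      by rewrite (bigD1 i) //= eqxx big1 // => j /andP[_ /negPf]; rewrite eq_sym => ->.
    by rewrite big1 // => j jA; case: eqP iA => // ->; rewrite jA.
  case: (boolP (i \in A)) => iA; rewrite ?add0n ?add1n.
    apply: ideal_pow_mul => //; apply: submx_trans uV _.
    exact: (sumsmx_sup i).
  by rewrite -[X in ideal_pow _ X]add0n; apply: ideal_powM => //; apply: ideal_pow_top.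
Qed.

Lemma ideal_pow0 c g : ideal_pow 0 c.+1 g -> g = 0.
Proof.
move Ec: c.+1 => d Hg; elim: Hg c Ec => {d g} // [d g h _ Hg _ Hh c Ec|d u g].
  by rewrite (Hg c) // (Hh c) // addr0.
by rewrite submx0 => /eqP -> *; rewrite raddf0 mul0r.
Qed.

(** Such a z avoids the finitely many proper subspaces that the sums of the V_i cut out in V_l. *)
Definition generic_in V l z := [/\ z != 0, (z <= V l)%MS &
  forall A, (z <= \sum_(i in A) V i)%MS -> (V l <= \sum_(i in A) V i)%MS].

(** For l in A, dividing by z costs one power of P_A, which is what the exponent loses. For l
    outside A the exponent is unchanged, and genericity leaves two cases: z is not in P_A and
    cancels freely, or V_l is contained in P_A. *)
Lemma colon_generic V l z b h : generic_in V l z ->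
  (forall A, ideal_pow (\sum_(i in A) V i)%MS (\sum_(i in A) (U_(l) + b)%MM i)
    (lform z * h)) ->
  forall A, ideal_pow (\sum_(i in A) V i)%MS (\sum_(i in A) b i) h.
Proof.
move=> [z0 zV gen] H A.
have sum_in B : l \in B ->
    (\sum_(i in B) (U_(l) + b)%MM i = (\sum_(i in B) b i).+1)%N.
  move=> lB; rewrite (bigD1 l) //= [in RHS](bigD1 l) //= mnmDE mnm1E eqxx.
  congr (_ + _).+1; apply: eq_bigr => i /andP[_ il].
  by rewrite mnmDE mnm1E eq_sym (negPf il).
have [lA|lA] := boolP (l \in A).
  apply: (@ideal_pow_colon_in _ _ _ _ z) => //.
    by apply: submx_trans zV _; apply: (sumsmx_sup l).
  by rewrite -sum_in.
have [zA|zA] := boolP (z <= \sum_(i in A) V i)%MS; last first.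
  apply: ideal_pow_colon_notin zA _.
  rewrite (eq_bigr (U_(l) + b)%MM) // => i iA.
  by rewrite mnmDE mnm1E; case: eqP iA lA => // -> ->.
(* V_l is contained in P_A, so adding l to A does not enlarge the ideal; the condition for the
   larger set has the extra power that division by z consumes. *)
have VA := gen _ zA.
have sub : (\sum_(i in l |: A) V i <= \sum_(i in A) V i)%MS.
  by rewrite big_setU1 //= addsmx_sub VA submx_refl.
apply: (@ideal_pow_colon_in _ _ _ _ z) => //.
apply: ideal_pow_submx sub _; apply: ideal_pow_leq (H (l |: A)).
by rewrite sum_in ?setU11 // ltnS big_setU1 //= leq_addl.
Qed.

Hypothesis K_infinite : forall s : seq K, exists c, c \notin s.

Lemma avoid_subspaces W (s : seq 'M[K]_n) :
  (forall P, P \in s -> ~~ (W <= P)%MS) ->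
  exists2 z : 'rV_n, (z <= W)%MS & forall P, P \in s -> ~~ (z <= P)%MS.
Proof.
elim: s => [|P s IH] Hs; first by exists 0; rewrite ?sub0mx.
have [|z zW zs] := IH; first by move=> Q Qs; apply: Hs; rewrite inE Qs orbT.
have /row_subPn[i wP] := Hs P (mem_head _ _); set w := row i W in wP.
have wW : (w <= W)%MS := row_sub i W.
have [zP|zP] := boolP (z <= P)%MS; last first.
  by exists z => // Q; rewrite inE => /orP[/eqP->|/zs].
(* Each Q contains w + c z for at most one c: the difference of two such vectors is a non-zero
   multiple of z, which is not in Q. *)
have [bad Hbad] : exists bad : seq K, forall c, c \notin bad ->
    forall Q, Q \in s -> ~~ ((w + c *: z)%R <= Q)%MS.
  elim: (s) zs => [|Q t IHt] zs; first by exists [::].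
  have [|bad Hbad] := IHt; first by move=> X Xt; apply: zs; rewrite inE Xt orbT.
  have [[c0 Hc0]|nc0] := EM (exists c0, ((w + c0 *: z)%R <= Q)%MS).
    exists (c0 :: bad) => c; rewrite inE negb_or => /andP[cc0 cbad] X.
    rewrite inE => /orP[/eqP->|]; last exact: Hbad.
    have := zs Q (mem_head _ _); apply: contra => Hc.
    rewrite -[z](scalerK (_ : c - c0 != 0)) ?subr_eq0 //; apply: scalemx_sub.
    have -> : (c - c0) *: z = w + c *: z - (w + c0 *: z).
      by rewrite scalerBl opprD addrACA subrr add0r.
    by apply: addmx_sub; [exact: Hc | rewrite eqmx_opp].
  exists bad => c cbad X; rewrite inE => /orP[/eqP->|]; last exact: Hbad.
  by apply/negP => Hc; apply: nc0; exists c.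
have [c cbad] := K_infinite bad; exists (w + c *: z).
  by rewrite addmx_sub // scalemx_sub.
move=> Q; rewrite inE => /orP[/eqP->|]; last exact: Hbad.
apply: contra wP => Hc; rewrite -[w](addrK (c *: z)).
by apply: addmx_sub; [exact: Hc | rewrite eqmx_opp scalemx_sub].
Qed.

Lemma generic_exists V l : V l != 0 -> exists z, generic_in V l z.
Proof.
move=> V0.
pose s := 0 :: [seq X <- [seq (\sum_(i in A) V i)%MS | A <- enum {set 'I_m}]
                     | ~~ (V l <= X)%MS].
have [P|z zV zs] := @avoid_subspaces (V l) s.
  by rewrite inE mem_filter => /orP[/eqP->|/andP[]//]; rewrite submx0.
exists z; split => // [|A zA].
  by have := zs 0 (mem_head _ _); rewrite submx0.
apply: contraLR zA => VA; apply: zs.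
by rewrite inE mem_filter VA map_f ?orbT // mem_enum.
Qed.

Lemma rank_elimination W z S : z != 0 -> (z <= W)%MS -> z *m S = 0 ->
  (\rank (W *m S) < \rank W)%N.
Proof.
move=> z0 zW zS; rewrite -[X in (_ < X)%N](mxrank_mul_ker W S).
rewrite -[X in (X < _)%N]addn0 ltn_add2l lt0n mxrank_eq0.
apply: contra z0 => /eqP ker0; rewrite -submx0 -ker0 sub_capmx zW.
exact/sub_kermxP.
Qed.

(* Restricting to the hyperplane z = 0 for a generic z in V_l only makes the
   conditions easier, and they pass to the quotient of a multiple of z. *)
Theorem pspace_intersection V a g : g \is (mdeg a).-homog ->
  (forall A, ideal_pow (\sum_(i in A) V i)%MS (\sum_(i in A) a i) g) ->
  pspace V a g.
Proof.
move Ed: (mdeg a) => d; elim: d => [|d IHd] in V a g Ed *.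
  have a0 : a = 0%MM by apply/eqP; rewrite -mdeg_eq0 Ed.
  rewrite a0 => hg _; have -> : g = (g@_0%MM)%:MP; last exact: pspace_const.
  apply/mpolyP => k; rewrite mcoeffC; have [->|k0] := eqVneq; first by rewrite mulr1.
  by rewrite mulr0 (dhomog_nemf_coeff hg) //= mdeg_eq0.
have [l al] : exists l, a l != 0%N.
  apply/existsP; rewrite -negb_forall; apply/negP => /forallP a0.
  suff a0' : a = 0%MM by rewrite a0' mdeg0 in Ed.
  by apply/mnmP => i; rewrite mnm0E; apply/eqP.
pose b := (a - U_(l))%MM.
have def_a : a = (U_(l) + b)%MM by rewrite addmC submK // lep1mP.
have Eb : mdeg b = d by apply/eqP; rewrite -eqSS -Ed def_a mdegD mdeg1.
(* The inner induction is on the rank of V_l, which drops on the hyperplane z = 0. If V_l = 0, the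
   condition for A = {l}, with exponent a_l > 0, forces g = 0. *)
move Er: (\rank (V l)) => r; elim/ltn_ind: r => r IHr in V g Er *.
move=> hg Hg; have [V0|V0] := eqVneq (V l) 0.
  have := Hg [set l]; rewrite !big_set1 V0 -(prednK (n := a l)) ?lt0n //.
  by move/ideal_pow0->; apply: pspace_zero.
have [z gz] := generic_exists V0; have [z0 zV gen] := gz.
have [S [zS elimS]] := lform_elimination z0.
have [|v Hv Ev] := @pspace_subst_lift V S a (lsubst S g).
  apply: (IHr (\rank (V l *m S))) => //; first by rewrite -Er (rank_elimination z0).
    exact: lsubst_homog.
  move=> A; apply: ideal_pow_submx (ideal_pow_subst S (Hg A)).
  by rewrite sumsmxMr.
(* The lift v agrees with g on the hyperplane, so g - v is a multiple of z; its cofactor is treated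
   by the outer induction, with a - e_l. *)
have [|h Eh] := elimS (g - v); first by rewrite rmorphB /= Ev subrr.
have hv := pspace_homog Hv; rewrite Ed in hv.
have [h' Eh' hh'] : exists2 h', lform z * h = lform z * h' & h' \is d.-homog.
  by apply: homog_quotient (lform_homog z) _; rewrite -Eh rpredB.
rewrite -[g](subrK v) Eh Eh'; apply: pspace_add => //.
rewrite def_a; apply: pspace_mul => //; apply: IHd => //.
apply: colon_generic gz _ => A; rewrite -def_a -Eh' -Eh -scaleN1r -mul_mpolyC.
apply: ideal_pow_add => //; rewrite -[X in ideal_pow _ X]add0n.
by apply: ideal_powM; [exact: ideal_pow_top | exact: pspace_ideal_pow].
Qed.

(** This is the formula for V^a \cap (z): the conditions at the ideals P_A pass to h, and they
    characterise V^b. *)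
Lemma pspace_colon V l z b h : generic_in V l z ->
  pspace V (U_(l) + b)%MM (lform z * h) -> pspace V b h.
Proof.
move=> gz Hh; have [z0 _ _] := gz; apply: pspace_intersection; last first.
  by apply: colon_generic gz _ => A; apply: pspace_ideal_pow.
have := pspace_homog Hh; rewrite mdegD mdeg1.
move=> /(homog_quotient (lform_homog z)) [h' /eqP].
by rewrite -subr_eq0 -mulrBr mulf_eq0 lform_eq0 (negPf z0) subr_eq0 => /eqP->.
Qed.

End ProductSpaces.

(** * Homology with coefficients in the modules M_a / (W_k) *)

Definition mconst m (d : nat) : 'X_{1..m} := [multinom d | i < m].

Lemma mconstE m d i : mconst m d i = d.
Proof. by rewrite /mconst mnmE. Qed.

Lemma mconstD m d e : (mconst m d + mconst m e = mconst m (d + e))%MM.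
Proof. by apply/mnmP => i; rewrite mnmDE !mconstE. Qed.

Lemma mconst0 m : mconst m 0 = 0%MM.
Proof. by []. Qed.

Lemma mdeg_mconst m d : mdeg (mconst m d) = (m * d)%N.
Proof.
rewrite mdegE (eq_bigr (fun=> d)) => [|i _]; last exact: mconstE.
by rewrite sum_nat_const card_ord.
Qed.

Section Rows.
Variables (K : fieldType) (n m : nat) (V : 'I_m -> 'M[K]_n).
Implicit Types (a b : 'X_{1..m}) (g h : {mpoly K[n]}) (u : 'rV[K]_n) (R S : 'M[K]_n).

Definition prow a p (x : 'rV[{mpoly K[n]}]_p) := forall k, pspace V a (x 0 k).

Arguments prow a {p} x.

Lemma prow0 a p : prow a (0 : 'rV_p).
Proof. by move=> k; rewrite mxE; apply: pspace_zero. Qed.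

Lemma prowD a p (x y : 'rV_p) : prow a x -> prow a y -> prow a (x + y).
Proof. by move=> Hx Hy k; rewrite mxE; apply: pspace_add. Qed.

Lemma prowB a p (x y : 'rV_p) : prow a x -> prow a y -> prow a (x - y).
Proof. by move=> Hx Hy k; rewrite !mxE; apply: pspaceB. Qed.

Lemma prowZ a b p g (x : 'rV_p) :
  pspace V a g -> prow b x -> prow (a + b)%MM (g *: x).
Proof. by move=> Hg Hx k; rewrite mxE; apply: pspaceM. Qed.

Lemma prow_mulmx a b p q (x : 'rV_p) (C : 'M_(p, q)) :
  prow a x -> (forall k l, pspace V b (C k l)) -> prow (a + b)%MM (x *m C).
Proof.
by move=> Hx HC k; rewrite mxE; apply: pspace_sum => l; apply: pspaceM.
Qed.

Lemma pspace_lform l u : (u <= V l)%MS -> pspace V U_(l)%MM (lform u).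
Proof.
move=> uV; rewrite -[lform u]mulr1 -[U_(l)%MM]addm0 -mpolyC1.
exact/pspace_mul/pspace_const.
Qed.

(** Serves the end of the descent along a flag, where W_k = V_l and M_a / (W_k) contributes
    nothing. *)
Lemma pspace_null_map l R a g : V l *m R = 0 -> a l != 0%N -> pspace V a g ->
  lsubst R g = 0.
Proof.
move=> VR al /(pspace_subst R) /(@pspace_ideal_pow _ _ _ _ _ _ [set l]).
by rewrite !big_set1 VR -(prednK (n := a l)) ?lt0n // => /ideal_pow0.
Qed.

(* The degree j part of the submodule Z.M_a of the rows over M_a, where Z is
   the positive degree part of the kernel of C over the product algebra and
   M_a is the sum of the spaces V^(a + (d, ..., d)). *)
Inductive boundary p q (C : 'M[{mpoly K[n]}]_(p, q)) a j : 'rV[{mpoly K[n]}]_p -> Prop :=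
| boundary0 : boundary C a j 0
| boundaryD x y : boundary C a j x -> boundary C a j y -> boundary C a j (x + y)
| boundaryZ e g z : (0 < e <= j)%N -> prow (mconst m e) z -> z *m C = 0 ->
    pspace V (a + mconst m (j - e))%MM g -> boundary C a j (g *: z).

Section Boundary.
Variables (p q : nat) (C : 'M[{mpoly K[n]}]_(p, q)).

Lemma boundary_cycle a j y : boundary C a j y -> y *m C = 0.
Proof.
elim=> [|x z _ Hx _ Hz|e g z _ _ zC _]; first by rewrite mul0mx.
  by rewrite mulmxDl Hx Hz addr0.
by rewrite -scalemxAl zC scaler0.
Qed.

Lemma boundary_prow a j y : boundary C a j y -> prow (a + mconst m j)%MM y.
Proof.
elim=> [|x z _ Hx _ Hz|e g z /andP[_ ej] Hz _ Hg]; first exact: prow0.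
  exact: prowD.
by rewrite -(subnK ej) -mconstD addmA; apply: prowZ.
Qed.

Lemma boundary_scale l a j u y : (u <= V l)%MS ->
  boundary C a j y -> boundary C (U_(l) + a)%MM j (lform u *: y).
Proof.
move=> uV; elim=> [|x z _ Hx _ Hz|e g z ej Hz zC Hg].
- by rewrite scaler0; apply: boundary0.
- by rewrite scalerDr; apply: boundaryD.
- rewrite scalerA; apply: (boundaryZ ej Hz zC).
  by rewrite -addmA; apply: pspace_mul.
Qed.

End Boundary.

(* W_k is encoded by the matrix R of a linear substitution with kernel (W_k),
   so that an equation modulo (W_k) is one between images under it. *)
Inductive flag l : 'M[K]_n -> Prop :=
| flag_nil : flag l 1%:M
| flag_cons R (z : 'rV_n) S : flag l R -> (z <= V l)%MS ->
    generic_in (fun i => V i *m R) l (z *m R) -> z *m R *m S = 0 ->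
    (forall g, lsubst S g = 0 -> exists h, g = lform (z *m R) * h) ->
    flag l (R *m S).

Local Notation mapR R := (map_mx (lsubst R : {mpoly K[n]} -> {mpoly K[n]})).

Lemma map_lsubst1 p (x : 'rV_p) : mapR 1%:M x = x.
Proof. by apply/rowP => k; rewrite mxE lsubst1. Qed.

Lemma map_lsubst_comp R S p (x : 'rV_p) : mapR (R *m S) x = mapR S (mapR R x).
Proof. by apply/rowP => k; rewrite !mxE lsubst_comp. Qed.

Lemma map_lsubstD R p (x y : 'rV_p) : mapR R (x + y) = mapR R x + mapR R y.
Proof. exact: map_mxD. Qed.

Lemma map_lsubstB R p (x y : 'rV_p) : mapR R (x - y) = mapR R x - mapR R y.
Proof. exact: map_mxB. Qed.

Lemma map_lsubst0 R p : mapR R (0 : 'rV_p) = 0.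
Proof. exact: map_mx0. Qed.

Lemma map_lsubstZ R g p (x : 'rV_p) : mapR R (g *: x) = lsubst R g *: mapR R x.
Proof. exact: map_mxZ. Qed.

Lemma map_lsubstM R p q (x : 'rV_p) (C : 'M_(p, q)) :
  mapR R (x *m C) = mapR R x *m mapR R C.
Proof. exact: map_mxM. Qed.

Lemma map_lsubst_colon R (z : 'rV_n) p (x : 'rV_p) : z *m R != 0 ->
  mapR R (lform z *: x) = 0 -> mapR R x = 0.
Proof.
move=> zR; rewrite map_lsubstZ => /rowP x0; apply/rowP => k.
move: (x0 k); rewrite !mxE lsubst_lform => /eqP.
by rewrite mulf_eq0 lform_eq0 (negPf zR) => /eqP.
Qed.

(* With C the last differential of F: the homology of F (x) M_a / (W_k) at the
   source of C vanishes in the degrees j > 0 of M_a. *)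
Definition acyclic p q (C : 'M[{mpoly K[n]}]_(p, q)) := forall a l R j x,
  flag l R -> (0 < j)%N -> prow (a + mconst m j)%MM x -> mapR R (x *m C) = 0 ->
  exists2 y, boundary C a j y & mapR R (x - y) = 0.

Hypothesis K_infinite : forall s : seq K, exists c, c \notin s.

(** Entrywise exactness of M_(a-e_l)/(W_k) -> M_a/(W_k) -> M_a/(W_(k+1)) in the middle. The colon
    formula is applied after the substitution [R], and the quotient is lifted back. *)
Lemma flag_step l R (z : 'rV_n) S b p (x : 'rV_p) :
  generic_in (fun i => V i *m R) l (z *m R) ->
  (forall g, lsubst S g = 0 -> exists h, g = lform (z *m R) * h) ->
  prow (U_(l) + b)%MM x -> mapR (R *m S) x = 0 ->
  exists2 u, prow b u & mapR R (x - lform z *: u) = 0.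
Proof.
move=> gz elimS Hx /rowP x0.
have /fin_all_exists2[u Hu Eu] k : exists2 g, pspace V b g &
    lsubst R (x 0 k - lform z * g) = 0.
  have := x0 k; rewrite !mxE -lsubst_comp => /elimS [h Eh].
  have := pspace_subst R (Hx k); rewrite Eh => /(pspace_colon K_infinite gz).
  case/pspace_subst_lift => g Hg Ehg; exists g => //.
  by rewrite rmorphB rmorphM /= lsubst_lform Eh Ehg subrr.
exists (\row_k u k) => [k|]; first by rewrite mxE.
by apply/rowP => k; have := Eu k; rewrite !mxE.
Qed.

(** Induction on the degree of a. If a_l > 0, one descends along flags from V_l. If a_l = 0, the
    hypothesis changes x by an element of (W_k) into a genuine cycle, which is handled with the
    empty flag. *)
Lemma acyclic_step p q (C : 'M[{mpoly K[n]}]_(p, q)) :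
  (forall a l R j x, flag l R -> (0 < j)%N -> prow (a + mconst m j)%MM x ->
    mapR R (x *m C) = 0 ->
    exists w, [/\ prow (a + mconst m j)%MM w, mapR R w = 0 & w *m C = x *m C]) ->
  acyclic C.
Proof.
move=> HN a; move Ed: (mdeg a) => d.
elim/ltn_ind: d => d IHd in a Ed * => l R j x fR j0 Hx xC.
(* The case a_i > 0, by induction on the rank of V_i modulo the flag: at rank 0 the row y itself
   vanishes modulo the flag; otherwise the flag is extended by a generic form. *)
have H2 i Q y : a i != 0%N -> flag i Q -> prow (a + mconst m j)%MM y ->
    mapR Q (y *m C) = 0 -> exists2 y', boundary C a j y' & mapR Q (y - y') = 0.
  move=> ai; move Er: (\rank (V i *m Q)) => r.
  elim/ltn_ind: r => r IHr in Q y Er * => fQ Hy yC.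
  have [VQ|VQ] := eqVneq (V i *m Q) 0.
    exists 0; first exact: boundary0.
    rewrite subr0; apply/rowP => k; rewrite !mxE.
    apply: (pspace_null_map VQ _ (Hy k)).
    by rewrite mnmDE addn_eq0 negb_and ai.
  have [z' gz'] := generic_exists K_infinite (V := fun t => V t *m Q) VQ.
  have [zQ0 /submxP[w Ez] _] := gz'; rewrite mulmxA in Ez.
  have [S [zS elimS]] := lform_elimination zQ0.
  have wV : (w *m V i <= V i)%MS := submxMl _ _.
  rewrite Ez in gz' zQ0 zS elimS; set z := w *m V i in gz' zQ0 zS elimS wV.
  have fQS : flag i (Q *m S) by apply: (flag_cons fQ wV).
  have [||y1 Hy1 Ey1] := IHr _ _ (Q *m S) y erefl fQS Hy.
  - rewrite -Er mulmxA; apply: (rank_elimination zQ0) => //.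
    exact: submxMr.
  - by rewrite map_lsubst_comp yC map_lsubst0.
  pose b := (a - U_(i))%MM.
  have def_a : a = (U_(i) + b)%MM by rewrite addmC submK // lep1mP.
  have [|u Hu Eu] := flag_step (b := (b + mconst m j)%MM) gz' elimS _ Ey1.
    by rewrite addmA -def_a; apply: prowB => //; apply: boundary_prow Hy1.
  (* Cancelling z shows that u is again a cycle modulo the flag, now over M_(a-e_i), where the outer
     induction applies. *)
  have uC : mapR Q (u *m C) = 0.
    apply: (map_lsubst_colon zQ0); rewrite scalemxAl.
    have := congr1 (mulmx^~ (mapR Q C)) Eu.
    rewrite -map_lsubstM mulmxBl mulmxBl (boundary_cycle Hy1) subr0 mul0mx.
    by rewrite map_lsubstB yC sub0r => /eqP; rewrite oppr_eq0 => /eqP.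
  have Eb : (mdeg b < d)%N by rewrite -Ed def_a mdegD mdeg1.
  have [y2 Hy2 Ey2] := IHd _ Eb b erefl i Q j u fQ j0 Hu uC.
  exists (y1 + lform z *: y2).
    by apply: boundaryD => //; rewrite def_a; apply: boundary_scale.
  rewrite opprD addrA -[y - y1](subrK (lform z *: u)) -addrA -scalerBr.
  by rewrite map_lsubstD Eu map_lsubstZ Ey2 scaler0 addr0.
(* Genuine cycles: for a = 0 such a y is itself a generator of the boundary module, with e = j and
   coefficient 1; otherwise some a_i is positive. *)
have H1 y : prow (a + mconst m j)%MM y -> y *m C = 0 -> boundary C a j y.
  move=> Hy yC; have [a0|a0] := eqVneq a 0%MM.
    rewrite -[y]scale1r; apply: (boundaryZ (e := j)); rewrite ?j0 ?leqnn //.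
      by rewrite a0 add0m in Hy.
    by rewrite subnn mconst0 addm0 a0 -mpolyC1; apply: pspace_const.
  have [i ai] : exists i, a i != 0%N.
    apply/existsP; rewrite -negb_forall; apply: contra a0 => /forallP a0.
    by apply/eqP/mnmP => i; rewrite mnm0E; apply/eqP.
  have [|y' Hy'] := H2 i 1%:M y ai (flag_nil i) Hy; first by rewrite map_lsubst1.
  by rewrite map_lsubst1 => /eqP; rewrite subr_eq0 => /eqP ->.
have [al|al] := eqVneq (a l) 0%N; last exact: H2 al fR Hx xC.
have [w [Hw Rw wC]] := HN _ _ _ _ _ fR j0 Hx xC.
exists (x - w).
  by apply: H1; [exact: prowB | rewrite mulmxBl wC subrr].
by rewrite opprB addrC subrK.
Qed.

(** Start of the induction along the resolution: without columns every row is a cycle, so the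
    correcting element can be 0. *)
Lemma acyclic_nil p (C : 'M[{mpoly K[n]}]_(p, 0)) : acyclic C.
Proof.
apply: acyclic_step => a l R j x _ _ _ _; exists 0.
by split; [exact: prow0 | exact: map_lsubst0 | apply/matrixP => ? []].
Qed.

(** Turns Z.M_a into the image of [C'] once [C'] generates the kernel of [C] up to degree j. The
    degree j - 1 of w reflects that [C'] raises degrees by one. *)
Lemma boundary_image p q (C : 'M[{mpoly K[n]}]_(p, q)) r (C' : 'M_(r, p)) a j y :
  (forall d x, (d < j)%N -> prow (mconst m d.+1) x -> x *m C = 0 ->
    exists2 w, prow (mconst m d) w & x = w *m C') ->
  boundary C a j y -> exists2 w, prow (a + mconst m j.-1)%MM w & y = w *m C'.
Proof.
move=> HC; elim=> [|x z _ [w Hw ->] _ [v Hv ->]|e g z /andP[e0 ej] Hz zC Hg].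
- by exists 0; rewrite ?mul0mx //; apply: prow0.
- by exists (w + v); rewrite ?mulmxDl //; apply: prowD.
- case: e => // e in e0 ej Hz Hg *; have [w Hw Ew] := HC _ _ ej Hz zC.
  exists (g *: w); last by rewrite Ew scalemxAl.
  case: j => // j in HC ej Hg *; rewrite subSS in Hg.
  by rewrite /= -(subnK (ej : e <= j)%N) -mconstD addmA; apply: prowZ.
Qed.

(** By [acyclic_step] it suffices to write v = x C', a cycle in (W_k), as w C' with w in (W_k).
    Modulo W_(k-1), v is z u with u a cycle, hence a boundary y = w' C' by acyclicity of [C]. Then z
    w' accounts for the top of the flag, and v - z y lies in (W_(k-1)). *)
Lemma acyclic_next p q r (C : 'M[{mpoly K[n]}]_(p, q)) (C' : 'M_(r, p)) :
  acyclic C -> C' *m C = 0 -> (forall k l, pspace V (mconst m 1) (C' k l)) ->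
  (forall d x, prow (mconst m d.+1) x -> x *m C = 0 ->
    exists2 w, prow (mconst m d) w & x = w *m C') ->
  acyclic C'.
Proof.
move=> HC CC HC' exC; apply: acyclic_step => a l R j x fR j0 Hx xC.
have Hv : prow (a + mconst m j.+1)%MM (x *m C').
  by rewrite -addn1 -mconstD addmA; apply: prow_mulmx.
have vC : x *m C' *m C = 0 by rewrite -mulmxA CC mulmx0.
move: (x *m C') Hv xC vC => {x Hx}.
elim: {R} fR => [|R z S fR IH zV gz zS elimS] v Hv Rv vC.
  exists 0; split; [exact: prow0|exact: map_lsubst0|].
  by rewrite map_lsubst1 in Rv; rewrite Rv mul0mx.
have zR0 : z *m R != 0 by case: gz.
(* As a_l may vanish, the factor from V_l that is divided off is taken from the extra (1,...,1)
   contributed by the entries of [C']. *)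
pose c := (mconst m 1 - U_(l))%MM.
have def_c : mconst m 1 = (U_(l) + c)%MM.
  by rewrite addmC submK // lep1mP mconstE.
have [|u Hu Eu] := flag_step (b := (a + c + mconst m j)%MM) gz elimS _ Rv.
  by rewrite !addmA -(addmC a) -(addmA a) -def_c -addmA mconstD.
have uC : mapR R (u *m C) = 0.
  apply: (map_lsubst_colon zR0); rewrite scalemxAl.
  have := congr1 (mulmx^~ (mapR R C)) Eu; rewrite -map_lsubstM mulmxBl vC mul0mx.
  by rewrite sub0r -scaleN1r map_lsubstZ => /eqP;
    rewrite rmorphN rmorph1 scaleN1r oppr_eq0 => /eqP.
have [y Hy Ey] := HC _ _ _ _ _ fR j0 Hu uC.
have [w Hw Ew] := boundary_image (fun d x _ => exC d x) Hy.
have Hzw : prow (a + mconst m j)%MM (lform z *: w).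
  rewrite -(prednK j0) -add1n -mconstD def_c.
  rewrite (_ : (a + _ = U_(l) + (a + c + mconst m j.-1))%MM); last first.
    by rewrite !addmA (addmC a).
  by apply: prowZ => //; apply: pspace_lform.
have [|||w1 [Hw1 Rw1 Ew1]] := IH (v - lform z *: y).
- apply: prowB => //; rewrite Ew scalemxAl -addn1 -mconstD addmA.
  exact: prow_mulmx.
- rewrite -[v](subrK (lform z *: u)) -addrA -scalerBr map_lsubstD Eu.
  by rewrite map_lsubstZ Ey scaler0 addr0.
- by rewrite mulmxBl vC -scalemxAl Ew -mulmxA CC mulmx0 scaler0 subr0.
exists (w1 + lform z *: w); split; first exact: prowD.
- rewrite map_lsubst_comp map_lsubstD Rw1 add0r map_lsubstZ lsubst_lform.
  by rewrite map_lsubstZ lsubst_lform zS raddf0 scale0r.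
- by rewrite mulmxDl Ew1 -scalemxAl -Ew subrK.
Qed.

End Rows.

Arguments prow {K n m} V a {p} x.

(** * Descent from K(t) to K *)

Section LinearKernels.
Variables (K : fieldType) (n : nat).

(** A matrix of maximal rank among those with row space inside [P] exhausts [P], since a missing
    vector could be adjoined. *)
Lemma subspace_row_free N (P : 'rV[K]_N -> Prop) :
  P 0 -> (forall c u v, P u -> P v -> P (c *: u + v)) ->
  exists r (U : 'M[K]_(r, N)), row_free U /\ forall u, P u <-> (u <= U)%MS.
Proof.
move=> P0 PD.
pose Q r := `[< exists2 U : 'M[K]_N, (forall u : 'rV_N, (u <= U)%MS -> P u) & \rank U = r >].
have Q0 : exists r, Q r.
  exists 0%N; apply/asboolP; exists 0; last exact: mxrank0.
  by move=> u; rewrite submx0 => /eqP->.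
have QN r : Q r -> (r <= N)%N by move=> /asboolP[U _ <-]; apply: rank_leq_row.
case: (ex_maxnP Q0 QN) => r /asboolP[U HU rU] maxr.
exists (\rank U), (row_base U); split; first exact: row_base_free.
move=> u; rewrite eq_row_base; split=> [Pu|]; last exact: HU.
apply: contraT => uU.
have: Q (\rank (U + u)%MS).
  apply/asboolP; exists (U + u)%MS => // v /sub_addsmxP[[w1 w2] /= ->].
  rewrite addrC [w2]mx11_scalar mul_scalar_mx; apply: (PD) => //.
  by apply: HU; apply: submxMl.
move=> /maxr; rewrite leqNgt -rU ltn_neqAle mxrankS ?addsmxSl // andbT negbK.
move=> /eqP eqr; case/negP: uU; apply: submx_trans (addsmxSr U u) _.
by have [_ <-] := mxrank_leqif_sup (addsmxSl U u); rewrite eqr.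
Qed.

Local Notation constr w := (map_mx (@mpolyC n K) w).

(** The coefficients at the finitely many monomials of degree at most d serve as coordinates, which
    reduces the claim to row vectors over K. *)
Lemma homog_rows_basis p d (P : 'rV[{mpoly K[n]}]_p -> Prop) :
  P 0 -> (forall c x y, P x -> P y -> P (c%:MP *: x + y)) ->
  (forall x, P x -> forall k, x 0 k \is d.-homog) ->
  exists r (C : 'M[{mpoly K[n]}]_(r, p)), [/\ forall i, P (row i C),
    forall x, P x -> exists w : 'rV[K]_r, x = constr w *m C &
    forall w : 'rV[K]_r, constr w *m C = 0 -> w = 0].
Proof.
move=> P0 PD Phom; pose M := {: 'X_{1..n < d.+1}}; pose N := #|M|.
pose phi (u : 'rV[K]_(p * N)) : 'rV[{mpoly K[n]}]_p :=
  \row_k \sum_(t < N) (vec_mx u) k t *: 'X_[bmnm (enum_val t)].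
have phiD c u v : phi (c *: u + v) = c%:MP *: phi u + phi v.
  apply/rowP => k; rewrite !mxE mul_mpolyC scaler_sumr -big_split.
  by apply: eq_bigr => t _; rewrite linearP /= !mxE scalerDl scalerA.
have phi0 : phi 0 = 0.
  by apply/rowP => k; rewrite !mxE big1 // => t _; rewrite raddf0 mxE scale0r.
have phi_coef u k t : (phi u 0 k)@_(bmnm (enum_val t)) = (vec_mx u) k t.
  rewrite mxE raddf_sum (bigD1 t) //= big1 => [|i it].
    by rewrite mcoeffZ mcoeffX eqxx mulr1 addr0.
  rewrite mcoeffZ mcoeffX; case: eqP => [/val_inj/enum_val_inj Eit|]; last by rewrite mulr0.
  by rewrite Eit eqxx in it.
have phi_inj u : phi u = 0 -> u = 0.
  move=> u0; rewrite -[u]vec_mxK; apply/eqP; rewrite mxvec_eq0; apply/eqP/matrixP => k t.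
  by rewrite -phi_coef u0 !mxE mcoeff0.
have phi_surj x : P x -> exists u, x = phi u.
  move=> Px; exists (mxvec (\matrix_(k, t) (x 0 k)@_(bmnm (enum_val t)))).
  apply/rowP => k; apply/mpolyP => mu.
  have [md|md] := ltnP (mdeg mu) d.+1.
    have -> : mu = bmnm (enum_val (enum_rank (BMultinom md))) by rewrite enum_rankK.
    by rewrite phi_coef mxvecK mxE.
  rewrite (dhomog_nemf_coeff (Phom x Px k)) /= ?gtn_eqF //.
  rewrite mxE raddf_sum big1 //= => t _; rewrite mcoeffZ mcoeffX.
  case: eqP => [Et|]; last by rewrite mulr0.
  by have := bmdeg (enum_val t); rewrite Et ltnNge md.
have [||r [U [freeU HU]]] := @subspace_row_free _ (fun u => P (phi u)).
- by rewrite phi0.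
- by move=> c u v Pu Pv; rewrite phiD; apply: (PD).
pose C := \matrix_(i < r) phi (row i U).
have phiM (w : 'rV_r) : constr w *m C = phi (w *m U).
  rewrite mulmx_sum_row [w *m U]mulmx_sum_row.
  elim/big_rec2: _ => [|i y x _ ->]; first by rewrite phi0.
  by rewrite phiD mxE rowK.
exists r, C; split => [i|x Px|w wC].
- by rewrite rowK; apply/HU/row_sub.
- have [u Eu] := phi_surj x Px; rewrite Eu in Px.
  by have /submxP[w Ew] := (HU u).1 Px; exists w; rewrite phiM -Ew.
- rewrite phiM in wC; apply/eqP; rewrite -(mulmx_free_eq0 _ freeU).
  exact/eqP/phi_inj.
Qed.

End LinearKernels.

(* L is the field of rational functions in one variable over K, f the inclusion
   of the polynomials. *)
Section Descent.
Variables (K L : fieldType) (n m : nat) (V : 'I_m -> 'M[K]_n).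
Variables (io : {rmorphism K -> L}) (f : {rmorphism {poly K} -> L}).
Hypothesis f_inj : injective f.
Hypothesis fC : forall c, f c%:P = io c.
Hypothesis f_frac : forall x : L, exists2 q : {poly K}, q != 0 & exists p : {poly K}, f q * x = f p.
Implicit Types (a b : 'X_{1..m}) (p q : nat).

Local Notation VL := (fun i => map_mx io (V i)).
Local Notation emb := (map_mpoly io : {mpoly K[n]} -> {mpoly L[n]}).

Lemma rational_functions_infinite (s : seq L) : exists c, c \notin s.
Proof.
apply/not_existsP => Hs.
pose t := [seq f 'X^i | i <- index_iota 0 (size s).+1].
have ut : uniq t.
  rewrite map_inj_uniq ?iota_uniq // => i j /f_inj /(congr1 (fun r : {poly K} => size r)).
  by rewrite !size_polyXn => -[].
have ts : {subset t <= s} by move=> x _; apply: contraT => /Hs.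
by have := uniq_leq_size ut ts; rewrite size_map size_iota subn0 ltnn.
Qed.

(** A list of pairs (c, x) stands for the sum of the c(t) x, an element of K[t] tensored with the
    rows over K; [comb_coef k] is its coefficient at t^k. *)
Definition comb p (s : seq ({poly K} * 'rV[{mpoly K[n]}]_p)) : 'rV[{mpoly L[n]}]_p :=
  \sum_(cx <- s) (f cx.1)%:MP *: map_mx emb cx.2.

Definition comb_coef p (k : nat) (s : seq ({poly K} * 'rV[{mpoly K[n]}]_p)) :
  'rV[{mpoly K[n]}]_p := \sum_(cx <- s) (cx.1`_k)%:MP *: cx.2.

(** The powers of t are linearly independent over K; this is applied to the coefficient of each
    monomial in each entry. *)
Lemma comb_inj p (s : seq ({poly K} * 'rV[{mpoly K[n]}]_p)) :
  comb s = 0 -> forall k, comb_coef k s = 0.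
Proof.
move=> s0 k; apply/rowP => j; rewrite mxE; apply/mpolyP => mu; rewrite mcoeff0.
have /(congr1 (coefp k)) : \sum_(cx <- s) cx.1 * ((cx.2 0 j)@_mu)%:P = 0.
  apply: f_inj; rewrite rmorph_sum rmorph0.
  transitivity ((comb s 0 j)@_mu); last by rewrite s0 mxE mcoeff0.
  rewrite /comb summxE raddf_sum; apply: eq_bigr => cx _ /=.
  by rewrite !mxE mcoeffCM mcoeff_map_mpoly rmorphM fC.
rewrite /= coef_sum coef0 => <-; rewrite summxE raddf_sum; apply: eq_bigr => cx _ /=.
by rewrite mxE mcoeffCM coefMC.
Qed.

Lemma comb_expand p (s : seq ({poly K} * 'rV[{mpoly K[n]}]_p)) :
  exists N, comb s = \sum_(k < N) (f 'X^k)%:MP *: map_mx emb (comb_coef k s).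
Proof.
pose N := \max_(cx <- s) size cx.1; exists N.
transitivity (\sum_(k < N) \sum_(cx <- s)
    (f ('X^k * (cx.1`_k)%:P))%:MP *: map_mx emb cx.2).
  rewrite exchange_big /= /comb big_seq [RHS]big_seq; apply: eq_bigr => cx cs.
  have sz : (size cx.1 <= N)%N.
    exact: (@leq_bigmax_seq _ s xpredT (fun cx => size cx.1) cx cs isT).
  rewrite -scaler_suml -raddf_sum -rmorph_sum; congr ((f _)%:MP *: _).
  apply/polyP => i; rewrite coef_sum.
  have [iN|Ni] := ltnP i N; last first.
    rewrite nth_default ?(leq_trans sz) // big1 // => k _.
    by rewrite coefMC coefXn gtn_eqF ?mul0r // (leq_trans (ltn_ord k) Ni).
  rewrite (bigD1 (Ordinal iN)) //= coefMC coefXn eqxx mul1r big1 ?addr0 // => k ki.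
  rewrite coefMC coefXn; case: eqP => [Ei|]; last by rewrite mul0r.
  by case/negP: ki; apply/eqP/val_inj.
apply: eq_bigr => k _; rewrite /comb_coef map_mx_sum scaler_sumr.
apply: eq_bigr => cx _; rewrite map_mxZ scalerA; congr (_ *: _).
by rewrite /= map_mpolyC -mpolyCM rmorphM fC.
Qed.

(* X is in the L-span of P, with a common denominator cleared. *)
Definition ext p (P : 'rV[{mpoly K[n]}]_p -> Prop) (X : 'rV[{mpoly L[n]}]_p) :=
  exists2 q : {poly K}, q != 0 &
  exists2 s, (forall cx, cx \in s -> P cx.2) & (f q)%:MP *: X = comb s.

Lemma comb_scale p c (s : seq ({poly K} * 'rV[{mpoly K[n]}]_p)) :
  comb [seq (c * cx.1, cx.2) | cx <- s] = (f c)%:MP *: comb s.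
Proof.
rewrite /comb big_map scaler_sumr; apply: eq_bigr => cx _ /=.
by rewrite scalerA rmorphM mpolyCM.
Qed.

Lemma comb_mulmx p q (C : 'M_(p, q)) (s : seq ({poly K} * 'rV[{mpoly K[n]}]_p)) :
  comb [seq (cx.1, cx.2 *m C) | cx <- s] = comb s *m map_mx emb C.
Proof.
rewrite /comb big_map mulmx_suml; apply: eq_bigr => cx _ /=.
by rewrite map_mxM -scalemxAl.
Qed.

Lemma comb_coef_mulmx p q (C : 'M_(p, q)) k
    (s : seq ({poly K} * 'rV[{mpoly K[n]}]_p)) :
  comb_coef k [seq (cx.1, cx.2 *m C) | cx <- s] = comb_coef k s *m C.
Proof.
rewrite /comb_coef big_map mulmx_suml; apply: eq_bigr => cx _ /=.
by rewrite -scalemxAl.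
Qed.

Lemma ext0 p (P : 'rV_p -> Prop) : ext P 0.
Proof. by exists 1; rewrite ?oner_eq0 //; exists [::]; rewrite // /comb big_nil scaler0. Qed.

Lemma extD p (P : 'rV_p -> Prop) X Y : ext P X -> ext P Y -> ext P (X + Y).
Proof.
move=> [q q0 [s Hs Es]] [r r0 [t Ht Et]].
exists (q * r); first by rewrite mulf_neq0.
exists ([seq (r * cx.1, cx.2) | cx <- s] ++ [seq (q * cx.1, cx.2) | cx <- t]).
  by move=> cx; rewrite mem_cat => /orP[] /mapP[cx' + ->]; [apply: Hs|apply: Ht].
rewrite {1}/comb big_cat -!/(comb _) !comb_scale -Es -Et !scalerA -!mpolyCM -!rmorphM.
by rewrite (mulrC r) scalerDr.
Qed.

Lemma extZ p (P : 'rV_p -> Prop) (c : L) X : ext P X -> ext P (c%:MP *: X).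
Proof.
move=> [q q0 [s Hs Es]]; have [r r0 [t Et]] := f_frac c.
exists (r * q); first by rewrite mulf_neq0.
exists [seq (t * cx.1, cx.2) | cx <- s].
  by move=> cx /mapP[cx' + ->]; apply: Hs.
rewrite comb_scale -Es !scalerA -!mpolyCM -Et [f (r * q)]rmorphM.
by rewrite -!mulrA [f q * c]mulrC.
Qed.

Lemma ext_scale p (P Q : 'rV_p -> Prop) (g : {mpoly K[n]}) X :
  (forall x, P x -> Q (g *: x)) -> ext P X -> ext Q (emb g *: X).
Proof.
move=> HQ [q q0 [s Hs Es]]; exists q => //.
exists [seq (cx.1, g *: cx.2) | cx <- s].
  by move=> cx /mapP[cx' + ->] /=; move=> /Hs /HQ.
rewrite scalerA mulrC -scalerA Es /comb big_map scaler_sumr.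
by apply: eq_bigr => cx _ /=; rewrite map_mxZ !scalerA mulrC.
Qed.

Lemma emb_lform (u : 'rV[K]_n) : emb (lform u) = lform (map_mx io u).
Proof.
rewrite /lform raddf_sum; apply: eq_bigr => j _ /=.
by rewrite map_mpolyZ map_mpolyX mxE.
Qed.

Lemma pspace_emb a g : pspace V a g -> pspace VL a (emb g).
Proof.
elim=> {a g} [a|c|a g h _ Hg _ Hh|a i u g uV _ H].
- by rewrite rmorph0; apply: pspace_zero.
- by rewrite map_mpolyC; apply: pspace_const.
- by rewrite rmorphD; apply: pspace_add.
- by rewrite rmorphM /= emb_lform; apply: pspace_mul; rewrite ?map_submx.
Qed.

Lemma pspace_ext a (g : {mpoly L[n]}) p (k : 'I_p) :
  pspace VL a g -> ext (prow V a) (g *: delta_mx 0 k).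
Proof.
elim=> {a g} [a|c|a g h _ Hg _ Hh|a i u g /submxP[w ->] _ H].
- by rewrite scale0r; apply: ext0.
- apply: extZ; exists 1; rewrite ?oner_eq0 //; exists [:: (1, delta_mx 0 k)].
    move=> cx; rewrite inE => /eqP-> /= j; rewrite mxE.
    by rewrite -mpolyC_nat; apply: pspace_const.
  by rewrite /comb big_seq1 map_delta_mx.
- by rewrite scalerDl; apply: extD.
(* The form is expanded over the rows of V_i, which are defined over K; only the scalars lie in
   L. *)
- rewrite mulmx_sum_row lform_sum mulr_suml scaler_suml.
  apply: (big_ind (ext (prow V _))); [exact: ext0 | exact: extD | move=> t _].
  rewrite lformZ -scalerAl -mul_mpolyC -scalerA; apply: extZ.
  rewrite -scalerA -map_row -emb_lform; apply: ext_scale H => x Hx.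
  by apply: prowZ => //; apply: pspace_lform; apply: row_sub.
Qed.

Lemma prow_ext a p (X : 'rV_p) : prow VL a X -> ext (prow V a) X.
Proof.
move=> HX; rewrite (row_sum_delta X).
apply: (big_ind (ext (prow V a))); [exact: ext0 | exact: extD | move=> k _].
exact: pspace_ext.
Qed.

Lemma prow_comb_coef a p k (s : seq ({poly K} * 'rV_p)) :
  (forall cx, cx \in s -> prow V a cx.2) -> prow V a (comb_coef k s).
Proof.
move=> Hs; rewrite /comb_coef big_seq; apply: (big_ind (prow V a)).
- exact: prow0.
- exact: prowD.
- move=> cx /Hs Hx j; rewrite mxE mul_mpolyC; exact/pspaceZ/Hx.
Qed.

Local Notation constr w := (map_mx (@mpolyC n K) w).

(** Flatness of L over K by hand: after clearing denominators, the coefficients at the powers of t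
    are kernel elements over K. *)
Lemma kernel_ext a p q r (C : 'M_(p, q)) (C' : 'M_(r, p)) :
  (forall x, prow V a x -> x *m C = 0 -> exists w : 'rV[K]_r, x = constr w *m C') ->
  forall X, prow VL a X -> X *m map_mx emb C = 0 ->
  exists2 W, prow VL 0%MM W & X = W *m map_mx emb C'.
Proof.
move=> HC X /prow_ext[t t0 [s Hs Es]] XC.
have sC k : comb_coef k s *m C = 0.
  rewrite -comb_coef_mulmx; apply: comb_inj.
  by rewrite comb_mulmx -Es -scalemxAl XC scaler0.
have /choice[w Hw] k := HC _ (prow_comb_coef k Hs) (sC k).
have [N EN] := comb_expand s.
have ft0 : f t != 0 by rewrite -(rmorph0 f) (inj_eq f_inj).
exists (((f t)^-1)%:MP *: \sum_(k < N) (f 'X^k)%:MP *: map_mx emb (constr (w k))).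
  move=> j; rewrite mxE summxE mul_mpolyC; apply/pspaceZ/pspace_sum => k.
  by rewrite !mxE map_mpolyC -mpolyCM; apply: pspace_const.
rewrite -scalemxAl mulmx_suml.
under eq_bigr => k _ do rewrite -scalemxAl -map_mxM -Hw.
by rewrite -EN -Es scalerA -mpolyCM mulVf // mpolyC1 scale1r.
Qed.

(** Once the common denominator is cleared, coefficients are compared at its leading power, where x
    is multiplied by a unit of K. *)
Lemma exact_descent a b p r (C' : 'M_(r, p)) x W :
  prow V a x -> prow VL b W -> map_mx emb x = W *m map_mx emb C' ->
  exists2 w, prow V b w & x = w *m C'.
Proof.
move=> Hx /prow_ext[t t0 [s Hs Es]] Ex.
pose k := (size t).-1.
have tk : t`_k != 0 by rewrite -lead_coefE lead_coef_eq0.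
have := @comb_inj _ ((- t, x) :: [seq (cx.1, cx.2 *m C') | cx <- s]).
rewrite /comb big_cons -/(comb _) comb_mulmx -Es -scalemxAl -Ex /=.
rewrite rmorphN mpolyCN scaleNr addNr => /(_ erefl k).
rewrite /comb_coef big_cons -/(comb_coef k _) comb_coef_mulmx /=.
rewrite coefN mpolyCN scaleNr => /eqP; rewrite addrC subr_eq0 => /eqP Ek.
exists (((t`_k)^-1)%:MP *: comb_coef k s).
  by move=> j; rewrite mxE mul_mpolyC; apply/pspaceZ/prow_comb_coef.
by rewrite -scalemxAl Ek scalerA -mpolyCM mulVf // mpolyC1 scale1r.
Qed.

(** The rows of [C'] form a K-basis of the degree-one part of the kernel of [C] over A(V), so [C']
    is the next map of the linear strand. *)
Definition kernel_basis p q r (C : 'M[{mpoly K[n]}]_(p, q)) (C' : 'M_(r, p)) :=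
  [/\ forall k l, pspace V (mconst m 1) (C' k l), C' *m C = 0,
      forall x, prow V (mconst m 1) x -> x *m C = 0 ->
        exists w : 'rV[K]_r, x = constr w *m C' &
      forall w : 'rV[K]_r, constr w *m C' = 0 -> w = 0].

Lemma kernel_basis_exists p q (C : 'M_(p, q)) :
  exists D : {r & 'M_(r, p)}, kernel_basis C (projT2 D).
Proof.
pose P x := prow V (mconst m 1) x /\ x *m C = 0.
have [|||r [C' [PC' gen free]]] := @homog_rows_basis K n p (m * 1) P.
- by split; [exact: prow0 | rewrite mul0mx].
- move=> c x y [Hx xC] [Hy yC]; split.
    by apply: prowD => // j; rewrite mxE mul_mpolyC; apply/pspaceZ/Hx.
  by rewrite mulmxDl -scalemxAl xC yC scaler0 addr0.
- by move=> x [Hx _] k; rewrite -mdeg_mconst; apply: pspace_homog (Hx k).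
exists (existT _ r C'); split=> //=.
- by move=> k l; have [/(_ l)] := PC' k; rewrite mxE.
- by apply/row_matrixP => i; rewrite row_mul row0; case: (PC' i).
- by move=> x Hx xC; apply: gen.
Qed.

Hypothesis m_gt0 : (0 < m)%N.

(** Acyclicity for M_(1,...,1), with the empty flag, writes a kernel element of degree at least 2 as
    a combination of kernel elements of smaller positive degree. Degree one holds by the choice of
    [C']. *)
Lemma kernel_basis_exact_ext p q r (C : 'M_(p, q)) (C' : 'M_(r, p)) :
  kernel_basis C C' -> acyclic VL (map_mx emb C) ->
  forall d x, prow VL (mconst m d.+1) x -> x *m map_mx emb C = 0 ->
  exists2 w, prow VL (mconst m d) w & x = w *m map_mx emb C'.
Proof.
move=> [_ _ gen _] acC; elim/ltn_ind => -[|d] IHd x Hx xC.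
  by apply: kernel_ext xC => //; exact: gen.
have Hx' : prow VL (mconst m 1 + mconst m d.+1)%MM x by rewrite mconstD.
have [|y Hy] := acC _ (Ordinal m_gt0) 1%:M d.+1 x (flag_nil _ _) isT Hx'.
  by rewrite map_lsubst1.
rewrite map_lsubst1 => /eqP; rewrite subr_eq0 => /eqP ->.
by have := boundary_image (fun e z ed => IHd e ed z) Hy; rewrite mconstD.
Qed.

Lemma kernel_basis_exact p q r (C : 'M_(p, q)) (C' : 'M_(r, p)) :
  kernel_basis C C' -> acyclic VL (map_mx emb C) ->
  forall d x, prow V (mconst m d.+1) x -> x *m C = 0 ->
  exists2 w, prow V (mconst m d) w & x = w *m C'.
Proof.
move=> HC acC d x Hx xC.
have [||W HW EW] := kernel_basis_exact_ext HC acC (d := d) (x := map_mx emb x).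
- by move=> j; rewrite mxE; apply: pspace_emb.
- by rewrite -map_mxM xC map_mx0.
exact: exact_descent Hx HW EW.
Qed.

Lemma kernel_basis_acyclic p q r (C : 'M_(p, q)) (C' : 'M_(r, p)) :
  kernel_basis C C' -> acyclic VL (map_mx emb C) -> acyclic VL (map_mx emb C').
Proof.
move=> HC acC; have [entC' CC' _ _] := HC.
apply: (acyclic_next rational_functions_infinite acC).
- by rewrite -map_mxM CC' map_mx0.
- by move=> k l; rewrite mxE; apply: pspace_emb.
- exact: kernel_basis_exact_ext.
Qed.

End Descent.

Lemma fraction_field_exists (R : idomainType) :
  exists (L : fieldType) (f : {rmorphism R -> L}), injective f /\
    forall x : L, exists2 q : R, q != 0 & exists p : R, f q * x = f p.
Proof.
exists {fraction R}, (@FracField.tofrac R); split=> [p q /eqP|x].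
  by rewrite tofrac_eq => /eqP.
elim/quotW: x => x; exists (\d_x); first exact: denom_ratioP.
exists (\n_x); rewrite /=; unlock FracField.tofrac.
rewrite -[LHS]FracField.pi_mul.
apply/eqmodP; rewrite /= FracField.equivfE /FracField.mulf.
by rewrite !numden_Ratio ?mul1r ?mulr1 ?oner_neq0 ?denom_ratioP // mulrC.
Qed.

(** * The linear resolution *)

Section KernelChain.
Variables (K : fieldType) (n m : nat) (V : 'I_m -> 'M[K]_n).

Definition next_kernel p q (C : 'M[{mpoly K[n]}]_(p, q)) : {r & 'M_(r, p)} :=
  projT1 (cid (kernel_basis_exists V C)).

Lemma next_kernelP p q (C : 'M_(p, q)) : kernel_basis V C (projT2 (next_kernel C)).
Proof. exact: projT2 (cid (kernel_basis_exists V C)). Qed.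

Definition chain_step (s : {p & {q & 'M[{mpoly K[n]}]_(p, q)}}) :
    {p & {q & 'M[{mpoly K[n]}]_(p, q)}} :=
  let D := next_kernel (projT2 (projT2 s)) in
  existT _ (projT1 D) (existT _ (projT1 s) (projT2 D)).

(** The stage i holds the map out of F_i together with its sizes. It starts with the 1 by 0 matrix,
    the map from F_0 = A(V) to 0, whose kernel in degree one is all of V_1...V_m. *)
Definition chain i : {p & {q & 'M[{mpoly K[n]}]_(p, q)}} :=
  iter i chain_step (existT (fun p => {q & 'M[{mpoly K[n]}]_(p, q)}) 1%N
    (existT (fun q => 'M[{mpoly K[n]}]_(1, q)) 0%N (const_mx 0))).

Definition chain_rk i : nat := projT1 (chain i).

Definition chain_mx i : 'M[{mpoly K[n]}]_(chain_rk i.+1, chain_rk i) :=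
  projT2 (projT2 (chain i.+1)).

Hypothesis m_gt0 : (0 < m)%N.

(** Acyclicity is carried along the chain over the infinite field L = K(t), for matrices that come
    from K; exactness is then descended to K. *)
Lemma chain_exact i d (x : 'rV_(chain_rk i)) :
  prow V (mconst m d.+1) x -> x *m projT2 (projT2 (chain i)) = 0 ->
  exists2 w, prow V (mconst m d) w & x = w *m chain_mx i.
Proof.
have [L [f [f_inj f_frac]]] := fraction_field_exists {poly K}.
pose io : {rmorphism K -> L} := f \o polyC.
have fC c : f c%:P = io c by [].
suff ac : acyclic (fun i => map_mx io (V i))
    (map_mx (map_mpoly io) (projT2 (projT2 (chain i)))).
  by apply: (kernel_basis_exact f_inj fC f_frac m_gt0 _ ac); apply: next_kernelP.
elim: {d x} i => [|i IH]; first exact: acyclic_nil (rational_functions_infinite f_inj) _ _.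
exact: (kernel_basis_acyclic f_inj fC f_frac m_gt0 (next_kernelP _) IH).
Qed.

Lemma chain_mx_entry i k l : pspace V (mconst m 1) (chain_mx i k l).
Proof. by case: (next_kernelP (projT2 (projT2 (chain i)))) => H _ _ _; apply: H. Qed.

Lemma chain_mx_comp i : chain_mx i *m projT2 (projT2 (chain i)) = 0.
Proof. by case: (next_kernelP (projT2 (projT2 (chain i)))). Qed.

Lemma chain_mx_free i (w : 'rV[K]_(chain_rk i.+1)) :
  map_mx (@mpolyC n K) w *m chain_mx i = 0 -> w = 0.
Proof. by case: (next_kernelP (projT2 (projT2 (chain i)))) => _ _ _ H; apply: H. Qed.

End KernelChain.

(** * Comparison of graded resolutions *)

Section GradedComponents.
Variables (K : fieldType) (R : comAlgType K) (gr : nat -> R -> Prop).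
Hypothesis SG : standard_graded gr.
Implicit Types (x y : R) (d e : nat).

Lemma gr0 d : gr d 0.
Proof. by have [] := gr_submod SG d. Qed.

Lemma grD d x y : gr d x -> gr d y -> gr d (x + y).
Proof. by have [_ H] := gr_submod SG d => Hx; rewrite -[x]scale1r; apply: (H). Qed.

Lemma grB d x y : gr d x -> gr d y -> gr d (x - y).
Proof.
have [_ H] := gr_submod SG d => Hx Hy.
by rewrite addrC -scaleN1r; apply: (H).
Qed.

Lemma lspan_mem (U : lmodType K) (S : U -> Prop) (z : U) : S z -> lspan S z.
Proof. by exists 1%N, (fun=> 1), (fun=> z); split=> //; rewrite big_ord1 scale1r. Qed.

Lemma grM d e x y : gr d x -> gr e y -> gr (d + e) (x * y).
Proof. by move=> Hx Hy; apply/(gr_mul SG)/lspan_mem; exists x, y. Qed.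

Definition gr_decomp x := cid (gr_sum SG x).
(** The decomposition is picked by choice; [gcomp_unique] shows that the component does not depend
    on it. *)
Definition gcomp d x : R :=
  if (d < projT1 (gr_decomp x))%N then projT1 (cid (projT2 (gr_decomp x))) d else 0.

Lemma gr_gcomp d x : gr d (gcomp d x).
Proof.
rewrite /gcomp; case: ifP => _; last exact: gr0.
by case: (cid (projT2 (gr_decomp x))) => u [].
Qed.

Lemma gcomp_sum x : exists2 N, x = \sum_(d < N) gcomp d x &
  forall d, (N <= d)%N -> gcomp d x = 0.
Proof.
exists (projT1 (gr_decomp x)) => [|d Nd]; last by rewrite /gcomp ltnNge Nd.
rewrite [LHS](projT2 (cid (projT2 (gr_decomp x)))).2.
by apply: eq_bigr => d _; rewrite /gcomp ltn_ord.
Qed.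

Lemma sum_ord_if N M (u : nat -> R) : (N <= M)%N ->
  \sum_(d < N) u d = \sum_(d < M) (if (d < N)%N then u d else 0).
Proof. by move=> NM; rewrite (big_ord_widen _ u NM) big_mkcond. Qed.

Lemma gcomp_unique N (u : nat -> R) : (forall d, gr d (u d)) ->
  forall d, gcomp d (\sum_(d < N) u d) = if (d < N)%N then u d else 0.
Proof.
move=> Hu d; set x := \sum_(d < N) u d; have [M Ex Mx] := gcomp_sum x.
pose w d := (if (d < N)%N then u d else 0) - (if (d < M)%N then gcomp d x else 0).
have Hw e : gr e (w e).
  by apply: grB; case: ifP => _ //; [exact: gr0 | exact: gr_gcomp | exact: gr0].
have w0 L : (N <= L)%N -> (M <= L)%N -> \sum_(d < L) w d = 0.
  move=> NL ML; rewrite sumrB -sum_ord_if // -(sum_ord_if (fun d => gcomp d x)) //.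
  by rewrite -Ex subrr.
pose L := (N + M + d.+1)%N; have dL : (d < L)%N by rewrite /L leq_addl.
have LN : (N <= L)%N by rewrite /L -addnA leq_addr.
have LM : (M <= L)%N by rewrite /L addnAC leq_addl.
have := gr_direct SG Hw (w0 L LN LM) dL; rewrite /w => /eqP; rewrite subr_eq0 => /eqP ->.
by case: ltnP => // /Mx.
Qed.

Lemma gcomp_hom e d x : gr e x -> gcomp d x = if d == e then x else 0.
Proof.
move=> Hx; pose u i := if i == e then x else 0.
have Hu i : gr i (u i) by rewrite /u; case: eqP => [->|_] //; exact: gr0.
have -> : gcomp d x = gcomp d (\sum_(i < e.+1) u i).
  rewrite big_ord_recr /= {2}/u eqxx big1 ?add0r // => i _.
  by rewrite /u ltn_eqF.
rewrite gcomp_unique // /u; case: eqP => [->|//]; first by rewrite leqnn.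
by rewrite if_same.
Qed.

Lemma gcompD d : {morph gcomp d : x y / x + y}.
Proof.
move=> x y; have [N Ex Nx] := gcomp_sum x; have [M Ey My] := gcomp_sum y.
have -> : x + y = \sum_(i < N + M) (gcomp i x + gcomp i y).
  rewrite big_split {1}Ex {1}Ey (sum_ord_if (fun i => gcomp i x) (leq_addr M N)).
  rewrite (sum_ord_if (fun i => gcomp i y) (leq_addl N M)); congr (_ + _); apply: eq_bigr => i _.
    by case: ltnP => // /Nx.
  by case: ltnP => // /My.
rewrite (gcomp_unique _ (u := fun i => gcomp i x + gcomp i y)) => [|i].
  case: ltnP => // NMd; rewrite Nx ?My ?addr0 //.
    exact: leq_trans (leq_addl _ _) NMd.
  exact: leq_trans (leq_addr _ _) NMd.
by apply: grD; apply: gr_gcomp.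
Qed.

Lemma gcomp0 d : gcomp d 0 = 0.
Proof. by rewrite (gcomp_hom d (gr0 0)) if_same. Qed.

Lemma gcompN d x : gcomp d (- x) = - gcomp d x.
Proof. by apply/eqP; rewrite -addr_eq0 -gcompD addNr gcomp0. Qed.

Lemma gcompB d x y : gcomp d (x - y) = gcomp d x - gcomp d y.
Proof. by rewrite gcompD gcompN. Qed.

Lemma gcomp_bigsum d I (r : seq I) (f : I -> R) :
  gcomp d (\sum_(i <- r) f i) = \sum_(i <- r) gcomp d (f i).
Proof. exact: (big_morph (gcomp d) (gcompD d) (gcomp0 d)). Qed.

Lemma gcompZ d c x : gcomp d (c *: x) = c *: gcomp d x.
Proof.
have [N Ex _] := gcomp_sum x; rewrite {1}Ex scaler_sumr gcomp_bigsum.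
rewrite [in RHS]Ex gcomp_bigsum scaler_sumr; apply: eq_bigr => i _.
have [_ H] := gr_submod SG i; have Hx := gr_gcomp i x.
have HZ : gr i (c *: gcomp i x) by rewrite -[_ *: _]addr0; apply: (H) => //; exact: gr0.
by rewrite !(gcomp_hom d HZ, gcomp_hom d Hx); case: ifP => _; rewrite ?scaler0.
Qed.

Lemma gcompM d e x y : gr e y ->
  gcomp d (x * y) = if (e <= d)%N then gcomp (d - e) x * y else 0.
Proof.
move=> Hy; have [N Ex Nx] := gcomp_sum x.
have -> : gcomp d (x * y) =
    \sum_(i < N) (if d == (i + e)%N then gcomp i x * y else 0).
  rewrite {1}Ex mulr_suml gcomp_bigsum; apply: eq_bigr => i _.
  by rewrite (gcomp_hom d (grM (gr_gcomp i x) Hy)).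
case: leqP => [ed|de]; last first.
  by rewrite big1 // => i _; rewrite ltn_eqF // ltn_addl.
have [dN|Nd] := ltnP (d - e) N; last first.
  rewrite Nx // mul0r big1 // => i _; case: eqP => // Ed.
  by move: Nd; rewrite Ed addnK leqNgt ltn_ord.
rewrite (bigD1 (Ordinal dN)) //= subnK // eqxx big1 ?addr0 // => i /negP ie.
by case: eqP => // Ed; case: ie; apply/eqP/val_inj; rewrite /= Ed addnK.
Qed.

Lemma gr0_1 : gr 0 1.
Proof. by apply/(gr_deg0 SG); exists 1; rewrite scale1r. Qed.

Lemma gcomp01 : gcomp 0 1 = 1.
Proof. by rewrite (gcomp_hom 0 gr0_1). Qed.

Lemma gcomp0M x y : gcomp 0 (x * y) = gcomp 0 x * gcomp 0 y.
Proof.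
have [N Ey _] := gcomp_sum y; rewrite {1}Ey mulr_sumr gcomp_bigsum.
rewrite [in RHS]Ey gcomp_bigsum mulr_sumr; apply: eq_bigr => i _.
rewrite (gcompM 0 x (gr_gcomp i y)) (gcomp_hom 0 (gr_gcomp i y)).
by case: (nat_of_ord i) => [|j] /=; rewrite ?subnn ?mulr0.
Qed.

Lemma irrelevantP x : irrelevant gr x <-> gcomp 0 x = 0.
Proof.
split=> [[k [c [u [Hu ->]]]]|x0].
  rewrite gcomp_bigsum big1 // => l _; rewrite gcompZ; have [d d0 Hd] := Hu l.
  by rewrite (gcomp_hom 0 Hd) ltn_eqF // scaler0.
have [N Ex _] := gcomp_sum x; exists N, (fun=> 1).
exists (fun l : 'I_N => if l == 0%N :> nat then 0 else gcomp l x); split.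
  move=> l; case: eqP => [_|/eqP l0]; first by exists 1%N => //; exact: gr0.
  by exists l; [rewrite lt0n | exact: gr_gcomp].
rewrite {1}Ex; apply: eq_bigr => l _; rewrite scale1r.
by case: eqP => [->|].
Qed.

Definition gcompz (z : int) x : R := match z with Posz d => gcomp d x | Negz _ => 0 end.

Lemma grz_gcompz z x : grz gr z (gcompz z x).
Proof. by case: z => [d|d] //=; apply: gr_gcomp. Qed.

Lemma gcompz_hom z x : grz gr z x -> gcompz z x = x.
Proof. by case: z => [d|d] //= Hx; rewrite ?Hx // (gcomp_hom d Hx) eqxx. Qed.

Lemma gcompz_bigsum z I (r : seq I) (f : I -> R) :
  gcompz z (\sum_(i <- r) f i) = \sum_(i <- r) gcompz z (f i).
Proof. by case: z => [d|d] /=; [exact: gcomp_bigsum | rewrite big1]. Qed.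

Lemma gcompzB z x y : gcompz z (x - y) = gcompz z x - gcompz z y.
Proof. by case: z => [d|d] /=; [exact: gcompB | rewrite subr0]. Qed.

Lemma gcompzM z w x y : grz gr w y -> gcompz (z + w) (x * y) = gcompz z x * y.
Proof.
case: w => [e|e] /= Hy; last first.
  by rewrite Hy !mulr0; case: (_ + _) => d //=; rewrite gcomp0.
case: z => [d|d] /=.
  by rewrite (gcompM _ _ Hy) leq_addl addnK.
rewrite mul0r; case E: (_ + _) => [i|//] /=.
suff Ee : e = (i + d.+1)%N.
  by rewrite (gcompM _ _ Hy) Ee addnS ltnNge leq_addr.
by apply/eqP; rewrite -eqz_nat PoszD -E NegzE addrAC addNr add0r.
Qed.

Lemma grzM z w x y : grz gr z x -> grz gr w y -> grz gr (z + w) (x * y).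
Proof.
by move=> Hx Hy; rewrite -(gcompz_hom Hx) -(gcompzM _ _ Hy); apply: grz_gcompz.
Qed.

Lemma grz_sum z I (r : seq I) (f : I -> R) :
  (forall i, grz gr z (f i)) -> grz gr z (\sum_(i <- r) f i).
Proof.
move=> Hf; rewrite (_ : \sum_(i <- r) f i = gcompz z (\sum_(i <- r) f i)).
  exact: grz_gcompz.
by rewrite gcompz_bigsum; apply: eq_bigr => i _; rewrite gcompz_hom.
Qed.

Lemma homog_mxM p q r (a : 'I_p -> int) (b : 'I_q -> int) (c : 'I_r -> int)
    (X : 'M[R]_(p, q)) (Y : 'M[R]_(q, r)) :
  homog_mx gr a b X -> homog_mx gr b c Y -> homog_mx gr a c (X *m Y).
Proof.
move=> HX HY k l; rewrite mxE; apply: grz_sum => i.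
by rewrite -(subrKA (b i)); apply: grzM.
Qed.

(** The degree-zero part of [X] as a map between graded free modules with basis degrees [a] and
    [b]. *)
Definition homog_part p q (a : 'I_p -> int) (b : 'I_q -> int) (X : 'M[R]_(p, q)) :=
  \matrix_(k, l) gcompz (a k - b l) (X k l).

Lemma homog_part_homog p q (a : 'I_p -> int) (b : 'I_q -> int) (X : 'M[R]_(p, q)) :
  homog_mx gr a b (homog_part a b X).
Proof. by move=> k l; rewrite mxE; apply: grz_gcompz. Qed.

Lemma homog_part_id p q (a : 'I_p -> int) (b : 'I_q -> int) (X : 'M[R]_(p, q)) :
  homog_mx gr a b X -> homog_part a b X = X.
Proof. by move=> HX; apply/matrixP => k l; rewrite mxE gcompz_hom. Qed.

Lemma homog_partM p q r (a : 'I_p -> int) (b : 'I_q -> int) (c : 'I_r -> int)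
    (X : 'M[R]_(p, q)) (Y : 'M[R]_(q, r)) :
  homog_mx gr b c Y -> homog_part a c (X *m Y) = homog_part a b X *m Y.
Proof.
move=> HY; apply/matrixP => k l; rewrite !mxE gcompz_bigsum.
apply: eq_bigr => i _; rewrite mxE -(gcompzM _ _ (HY i l)).
by rewrite subrKA.
Qed.

Lemma homog_partB p q (a : 'I_p -> int) (b : 'I_q -> int) (X Y : 'M[R]_(p, q)) :
  homog_part a b (X - Y) = homog_part a b X - homog_part a b Y.
Proof. by apply/matrixP => k l; rewrite !mxE gcompzB. Qed.

Lemma irr_row_homog_part p (a : 'I_1 -> int) (b : 'I_p -> int) (x : 'rV[R]_p) :
  irr_row gr x -> irr_row gr (homog_part a b x).
Proof.
move=> Hx k; apply/irrelevantP; rewrite mxE; have /irrelevantP := Hx k.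
case: (a 0 - b k) => [d|d] /=; last by rewrite gcomp0.
by rewrite (gcomp_hom 0 (gr_gcomp d _)); case: d.
Qed.

Lemma irrelevantD x y : irrelevant gr x -> irrelevant gr y -> irrelevant gr (x + y).
Proof.
move=> /irrelevantP Hx /irrelevantP Hy; apply/irrelevantP.
by rewrite gcompD Hx Hy addr0.
Qed.

Lemma irr_rowD p (x y : 'rV[R]_p) : irr_row gr x -> irr_row gr y -> irr_row gr (x + y).
Proof. by move=> Hx Hy k; rewrite mxE; apply: irrelevantD. Qed.

Lemma irr_row_mulmx p q (x : 'rV[R]_p) (X : 'M_(p, q)) :
  irr_row gr x -> irr_row gr (x *m X).
Proof.
move=> Hx k; apply/irrelevantP; rewrite mxE gcomp_bigsum big1 // => i _.
by rewrite gcomp0M; have /irrelevantP -> := Hx i; rewrite mul0r.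
Qed.

End GradedComponents.

(** * Comparison of two resolutions up to homotopy *)

Section Comparison.
Variables (K : fieldType) (R : comAlgType K) (gr : nat -> R -> Prop).
Hypothesis SG : standard_graded gr.

Definition res_cycle (F : free_complex R) i : 'rV[R]_(rk F i) -> Prop :=
  match i return 'rV[R]_(rk F i) -> Prop with
  | 0 => fun v => irrelevant gr ((v *m augm F) 0 0)
  | i'.+1 => fun v => v *m dmap F i' = 0
  end.

Lemma res_cycleP F i (v : 'rV_(rk F i)) : is_resolution gr F ->
  res_cycle v <-> exists w, v = w *m dmap F i.
Proof.
move=> HF; case: i v => [|i] v; [exact: (res_exact0 HF) | exact: (res_exact HF)].
Qed.

Lemma res_lift F i p (X : 'M_(p, rk F i)) : is_resolution gr F ->
  (forall k, res_cycle (row k X)) -> exists Y, X = Y *m dmap F i.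
Proof.
move=> HF HX.
have /fin_all_exists[w Hw] k : exists w, row k X = w *m dmap F i.
  exact/(res_cycleP _ HF).
exists (\matrix_k w k); apply/row_matrixP => k.
by rewrite row_mul rowK Hw.
Qed.

Lemma res_dmap_cycle F i (w : 'rV_(rk F i.+1)) : is_resolution gr F ->
  res_cycle (w *m dmap F i).
Proof. by move=> HF; apply/(res_cycleP _ HF); exists w. Qed.

Lemma res_comp F i : is_resolution gr F -> dmap F i.+1 *m dmap F i = 0.
Proof.
move=> HF; apply/row_matrixP => k; rewrite row0 -[X in row k X]mul1mx row_mul.
by rewrite mulmxA; apply: (@res_dmap_cycle F i.+1).
Qed.

Lemma augm_section F : is_resolution gr F -> exists2 v : 'rV_(rk F 0),
  homog_mx gr (fun=> 0) (@shift _ _ F 0) v & gcomp SG 0 ((v *m augm F) 0 0) = 1.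
Proof.
move=> HF; have [v /(irrelevantP SG) Hv] := res_augm_surj HF.
exists (homog_part SG (fun=> 0) (@shift _ _ F 0) v); first exact: homog_part_homog.
rewrite -(homog_partM SG (c := fun=> 0) (fun=> 0) v (res_augm_homog HF)) mxE subrr /=.
rewrite (gcomp_hom SG 0 (gr_gcomp SG 0 _)) /=.
by move: Hv; rewrite gcompB gcomp01 => /eqP; rewrite subr_eq0 => /eqP.
Qed.

(* phi and psi are the degree i parts of inverse homotopy equivalences, h is the
   homotopy, and E stands for the differential followed by the previous homotopy. *)
Definition comparison (F G : free_complex R) i :=
  exists (phi : 'M_(rk F i, rk G i)) (psi : 'M_(rk G i, rk F i))
         (h : 'M_(rk F i, rk F i.+1)) (E : 'M_(rk F i, rk F i)),
  [/\ homog_mx gr (@shift _ _ F i) (@shift _ _ G i) phi,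
      (forall k, res_cycle (row k (dmap F i *m phi))) /\
      (forall k, res_cycle (row k (dmap G i *m psi))),
      1%:M = phi *m psi + h *m dmap F i + E,
      dmap F i *m E = 0 &
      forall x, @tensor_cycle _ _ gr F i x -> irr_row gr (x *m E)].

Lemma comparison_exists F G i :
  is_resolution gr F -> is_resolution gr G -> comparison F G i.
Proof.
move=> HF HG; elim: i => [|i [phi [psi [h [E [hphi [cphi cpsi] E1 DE tE]]]]]].
  (* In degree 0 the maps are one augmentation followed by a lift of 1 through the other; both
     preserve the augmentation modulo R_+. *)
  have [v hv v1] := augm_section HG; have [w _ w1] := augm_section HF.
  have pi_augm p (H : free_complex R) (u : 'rV_(rk H 0)) (c : 'cV_p) (X : 'rV_p) :
      gcomp SG 0 ((u *m augm H) 0 0) = 1 ->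
      gcomp SG 0 ((X *m (c *m u) *m augm H) 0 0) = gcomp SG 0 ((X *m c) 0 0).
    move=> u1; rewrite mulmxA -mulmxA [X *m c in LHS]mx11_scalar mul_scalar_mx mxE.
    by rewrite gcomp0M u1 mulr1.
  have [h Eh] : exists h, 1%:M - augm F *m v *m (augm G *m w) = h *m dmap F 0.
    apply: res_lift => // k; apply/(irrelevantP SG).
    rewrite rowE mulmxBr mulmx1 mulmxBl mxE [X in _ + X]mxE gcompB.
    by rewrite (mulmxA (delta_mx 0 k)) pi_augm // pi_augm // subrr.
  exists (augm F *m v), (augm G *m w), h, 0; split.
  - have := homog_mxM SG (res_augm_homog HF) hv; exact.
  - split=> k; apply/(irrelevantP SG); rewrite row_mul pi_augm // rowE.
      apply/(irrelevantP SG); exact: (@res_dmap_cycle F 0).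
    apply/(irrelevantP SG); exact: (@res_dmap_cycle G 0).
  - by rewrite addr0 -Eh addrC subrK.
  - by rewrite mulmx0.
  - by move=> x _ k; rewrite mulmx0 mxE; apply/(irrelevantP SG)/gcomp0.
have [phi0 Ephi0] := res_lift HG cphi.
have [psi' Epsi'] := res_lift HF cpsi.
(* The lift need not be homogeneous; its degree-zero part still lifts, because the maps around it
   are homogeneous. *)
pose phi' := homog_part SG (@shift _ _ F i.+1) (@shift _ _ G i.+1) phi0.
have hDphi := homog_mxM SG (@res_homog _ _ _ _ HF i) hphi.
have Ephi' : dmap F i *m phi = phi' *m dmap G i.
  by rewrite -(homog_part_id SG hDphi) Ephi0 (homog_partM SG _ _ (@res_homog _ _ _ _ HG i)).
(* Composed with [dmap F i], the left side becomes [dmap F i *m E], which is 0, so exactness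
   provides the next homotopy. *)
have [h' Eh'] : exists h', 1%:M - phi' *m psi' - dmap F i *m h = h' *m dmap F i.+1.
  apply: res_lift => // k; rewrite /= -row_mul.
  suff -> : (1%:M - phi' *m psi' - dmap F i *m h) *m dmap F i = 0 by rewrite row0.
  have E2 : E = 1%:M - phi *m psi - h *m dmap F i.
    by rewrite -addrA -opprD E1 [_ + E]addrC addrK.
  rewrite !mulmxBl mul1mx -(mulmxA phi') -Epsi' (mulmxA phi') -Ephi' -DE E2.
  by rewrite !mulmxBr mulmx1 !mulmxA.
exists phi', psi', h', (dmap F i *m h); split.
- exact: homog_part_homog.
- split=> k /=; rewrite -row_mul -mulmxA.
    by rewrite -Ephi' mulmxA res_comp // mul0mx row0.
  by rewrite -Epsi' mulmxA res_comp // mul0mx row0.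
- by rewrite -Eh' -addrA subrK addrC subrK.
- by rewrite mulmxA res_comp // mul0mx.
- by move=> x Hx; rewrite mulmxA; apply: irr_row_mulmx.
Qed.

(** Up to homotopy, a cycle of degree j in F_i tensor K passes through G_i tensor K, which lives in
    degree i only. For j different from i its image there is 0, and the homotopy exhibits it as a
    boundary. *)
Theorem Koszul_linear_resolution (G : free_complex R) :
  is_resolution gr G -> (forall i k, @shift _ _ G i k = i%:Z) -> Koszul gr.
Proof.
move=> HG shG; split=> // i j ij; split; first by exists G.
move=> F HF x hx tx.
have [phi [psi [h [E [hphi _ E1 _ tE]]]]] := comparison_exists i HF HG.
pose y := homog_part SG (fun=> j) (@shift _ _ F i.+1) (x *m h).
exists y; first by move=> k; apply: (homog_part_homog SG (fun=> j) _ _ 0).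
have hx' : homog_mx gr (fun=> j) (@shift _ _ F i) x by move=> k l; rewrite ord1.
rewrite -(homog_part_id SG hx') -(homog_partM SG _ _ (@res_homog _ _ _ _ HF i)) -homog_partB.
apply: irr_row_homog_part.
have -> : x - x *m h *m dmap F i = x *m phi *m psi + x *m E.
  rewrite -{1}[x]mulmx1 E1 !mulmxDr !mulmxA addrAC.
  by rewrite addrK.
apply: irr_rowD (tE _ tx) => //; apply: irr_row_mulmx => // k.
have := homog_mxM SG hx' hphi 0 k; rewrite shG => Hz; apply/(irrelevantP SG).
case: (j - i%:Z) (subr_eq0 j i%:Z) Hz => [[|d]|d] /=.
- by rewrite eqxx => /esym/eqP Eji; case: ij.
- by move=> _ Hd; rewrite (gcomp_hom SG 0 Hd).
- by move=> _ ->; apply: gcomp0.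
Qed.

End Comparison.

(** * The algebra A(V) *)

Section LinearSpan.
Variables (K : fieldType) (U : lmodType K).
Implicit Types (S : U -> Prop) (x y : U).

Lemma lspan0 S : lspan S 0.
Proof. by exists 0%N, (fun=> 0), (fun=> 0); split=> [[]|] //; rewrite big_ord0. Qed.

Lemma lspanZ S c x : lspan S x -> lspan S (c *: x).
Proof.
move=> [k [a [u [Hu ->]]]]; exists k, (fun l => c * a l), u; split=> //.
by rewrite scaler_sumr; apply: eq_bigr => l _; rewrite scalerA.
Qed.

Lemma lspanD S x y : lspan S x -> lspan S y -> lspan S (x + y).
Proof.
move=> [k [a [u [Hu ->]]]] [l [b [v [Hv ->]]]].
exists (k + l)%N, (fun i => match split i with inl j => a j | inr j => b j end).
exists (fun i => match split i with inl j => u j | inr j => v j end); split.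
  by move=> i; case: (split i).
rewrite big_split_ord; congr (_ + _); apply: eq_bigr => i _.
  by rewrite (unsplitK (inl i)).
by rewrite (unsplitK (inr i)).
Qed.

Lemma lspan_elim S (P : U -> Prop) : P 0 -> (forall c x, S x -> P (c *: x)) ->
  (forall x y, P x -> P y -> P (x + y)) -> forall x, lspan S x -> P x.
Proof.
move=> P0 PZ PD x [k [c [u [Hu ->]]]]; apply: (big_ind P) => // l _; exact: PZ.
Qed.

End LinearSpan.

Lemma lspan_mull (K : fieldType) (A : comAlgType K) (S T : A -> Prop) a x :
  (forall y, S y -> T (a * y)) -> lspan S x -> lspan T (a * x).
Proof.
move=> ST; elim/lspan_elim => {x} [|c x Sx|x y Hx Hy].
- by rewrite mulr0; apply: lspan0.
- by rewrite -scalerAr; apply/lspanZ/lspan_mem/ST.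
- by rewrite mulrDr; apply: lspanD.
Qed.

Lemma lspanM (K : fieldType) (A : comAlgType K) (S : A -> Prop) x y :
  (forall a b, S a -> S b -> S (a * b)) -> lspan S x -> lspan S y -> lspan S (x * y).
Proof.
move=> SM Hx Hy; elim/lspan_elim: Hx => [|c a Sa|a b Ha Hb].
- by rewrite mul0r; apply: lspan0.
- rewrite -scalerAl; apply: lspanZ; apply: lspan_mull Hy => b; exact: SM.
- by rewrite mulrDl; apply: lspanD.
Qed.

(** * Factorisation of elements of product spaces *)

Section ProductSpaceSplit.
Variables (K : fieldType) (n m : nat) (W : 'I_m -> 'M[K]_n).

(** Each linear factor from the i-th space is charged to a while a_i is positive, and to b
    otherwise. *)
Lemma pspace_split a b g : pspace W (a + b)%MM g ->
  lspan (fun z => exists x y, [/\ pspace W a x, pspace W b y & z = x * y]) g.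
Proof.
move Ec: (a + b)%MM => c Hg.
elim: Hg a b Ec => {c g} [c|c|c g h _ Hg _ Hh|c i u g uW _ H] a b Ec.
- exact: lspan0.
- have /eqP := Ec; rewrite mnmD_eq0 => /andP[/eqP-> /eqP->].
  apply: lspan_mem; exists c%:MP, 1; rewrite mulr1 -mpolyC1.
  by split=> //; apply: pspace_const.
- by apply: lspanD; [apply: Hg | apply: Hh].
- have mulS a' b' : (c = a' + b')%MM ->
      (forall x y, pspace W a' x -> pspace W b' y ->
        exists x' y', [/\ pspace W a x', pspace W b y' & lform u * (x * y) = x' * y']) ->
      lspan (fun z => exists x y, [/\ pspace W a x, pspace W b y & z = x * y])
        (lform u * g).
    move=> Ec' HS; apply: lspan_mull (H _ _ (esym Ec')).
    by move=> z [x [y [Hx Hy ->]]]; apply: HS.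
  have [ai|ai] := eqVneq (a i) 0%N.
    have bi : (U_(i) <= b)%MM.
      rewrite lep1mP; have := congr1 (fun mu : 'X_{1..m} => mu i) Ec.
      by rewrite !mnmDE mnm1E eqxx ai add0n => ->.
    apply: (mulS a (b - U_(i))%MM).
      by apply: (@addmI _ U_(i)%MM); rewrite -Ec -[in LHS](submK bi) [in RHS]addmC -addmA.
    move=> x y Hx Hy; exists x, (lform u * y); split=> //; last by rewrite mulrCA.
    by rewrite -(submK bi) addmC; apply: pspace_mul.
  have ai' : (U_(i) <= a)%MM by rewrite lep1mP.
  apply: (mulS (a - U_(i))%MM b).
    by apply: (@addmI _ U_(i)%MM); rewrite -Ec -[in LHS](submK ai') addmA [(U_(i) + _)%MM]addmC.
  move=> x y Hx Hy; exists (lform u * x), y; split=> //; last by rewrite mulrA.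
  by rewrite -(submK ai') addmC; apply: pspace_mul.
Qed.

Lemma pspace_squarefree a g : pspace W a g -> (forall i, a i <= 1)%N ->
  lspan (fun z => exists2 u : 'I_m -> 'rV[K]_n, (forall i, (u i <= W i)%MS) &
    z = \prod_(i | a i == 1%N) lform (u i)) g.
Proof.
elim=> {a g} [a|c|a g h _ Hg _ Hh|a i u g uW _ H] a1.
- exact: lspan0.
- rewrite -alg_mpolyC; apply/lspanZ/lspan_mem; exists (fun=> 0).
    by move=> i; apply: sub0mx.
  by rewrite big1 // => i; rewrite mnm0E.
- by apply: lspanD; [apply: Hg | apply: Hh].
- have ai : a i = 0%N.
    by have := a1 i; rewrite mnmDE mnm1E eqxx ltnS leqn0 => /eqP.
  have {}/H H : forall j, (a j <= 1)%N.
    by move=> j; apply: leq_trans (a1 j); rewrite mnmDE leq_addl.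
  apply: lspan_mull H => z [v Hv ->].
  exists (fun j => if j == i then u else v j) => [j|]; first by case: eqP => [->|].
  rewrite [RHS](bigD1 i) /=; last by rewrite mnmDE mnm1E eqxx ai.
  rewrite eqxx; congr (_ * _); apply: eq_big => [j|j].
    rewrite mnmDE mnm1E (eq_sym i); case: (eqVneq j i) => [->|_]; last by rewrite andbT.
    by rewrite ai andbF.
  by case: (eqVneq j i) => [->|//]; rewrite ai.
Qed.

Lemma pspace0_const g : pspace W 0%MM g -> exists c, g = c%:MP.
Proof.
move=> /pspace_homog; rewrite mdeg0 => hg; exists g@_0%MM; apply/mpolyP => k.
rewrite mcoeffC; have [->|k0] := eqVneq; first by rewrite mulr1.
by rewrite mulr0 (dhomog_nemf_coeff hg) //= mdeg_eq0.
Qed.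

End ProductSpaceSplit.

(** * Grading and linear resolution of A(V) *)

Section ProductAlgebraKoszul.
Variables (K : fieldType) (n m : nat).
Hypothesis m_gt0 : (0 < m)%N.
Variable V : 'I_m -> submodClosed {mpoly K[n]}.
Hypothesis V_linear : forall i f, f \in V i -> f \is 1.-homog.

Lemma linear_space_matrix i : exists U : 'M[K]_n,
  forall u : 'rV_n, (lform u \in V i) <-> (u <= U)%MS.
Proof.
have [||r [U [_ HU]]] := @subspace_row_free K n (fun u => lform u \in V i).
- by rewrite raddf0 rpred0.
- by move=> c u v Hu Hv; rewrite lformD lformZ rpredD // rpredZ.
by exists <<U>>%MS => u; rewrite genmxE; apply: HU.
Qed.

Definition form_mx i : 'M[K]_n := projT1 (cid (linear_space_matrix i)).
Local Notation W := form_mx.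

Lemma form_mxP i (u : 'rV_n) : lform u \in V i <-> (u <= W i)%MS.
Proof. by rewrite /form_mx; case: (cid _) => U HU; apply: HU. Qed.

Lemma prod_spaceP g : prod_space V g <-> pspace W (mconst m 1) g.
Proof.
split=> [Hg|/pspace_squarefree].
  elim/lspan_elim: Hg => [|c y [v Hv ->]|y z Hy Hz]; [exact: pspace_zero| |exact: pspace_add].
  apply: pspaceZ; rewrite (_ : mconst m 1 = (\sum_(i < m) U_(i))%MM); last first.
    apply/mnmP => i; rewrite mconstE mnm_sumE (bigD1 i) //= mnm1E eqxx big1 //.
    by move=> j ji; rewrite mnm1E (negPf ji).
  apply: (big_ind2 (pspace W)) => [|a f b h|i _].
  - by rewrite -mpolyC1; apply: pspace_const.
  - exact: pspaceM.
  - have Ev := homog1_lform (V_linear (Hv i)); rewrite Ev; apply: pspace_lform.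
    by apply/form_mxP; rewrite -Ev.
move=> H; have {H} := H (fun i => eq_leq (mconstE 1 i)).
elim/lspan_elim => [|c y [u Hu ->]|y z]; [exact: lspan0| |exact: lspanD].
apply/lspanZ/lspan_mem; exists (fun i => lform (u i)) => [i|].
  exact/form_mxP.
by apply: eq_bigl => i; rewrite mconstE.
Qed.

Lemma pspace_gen_subalg d g : pspace W (mconst m d) g -> gen_subalg (prod_space V) g.
Proof.
have gen0 : gen_subalg (prod_space V) 0.
  by rewrite -(scale0r 1); apply: gen_scalar.
elim: d g => [|d IHd] g.
  by rewrite mconst0 => /pspace0_const[c ->]; rewrite -alg_mpolyC; apply: gen_scalar.
rewrite -add1n -mconstD => /pspace_split.
elim/lspan_elim => [|c z [x [y [Hx Hy ->]]]|y z]; [exact: gen0| |exact: gen_add].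
rewrite -mulr_algl; apply: gen_mul; first exact: gen_scalar.
by apply: gen_mul; [apply/gen_mem/prod_spaceP | apply: IHd].
Qed.

Lemma gen_subalg_lspan g : gen_subalg (prod_space V) g ->
  lspan (fun z => exists d, pspace W (mconst m d) z) g.
Proof.
elim=> {g} [c|g Hg|g h _ Hg _ Hh|g h _ Hg _ Hh].
- apply/lspanZ/lspan_mem; exists 0%N; rewrite mconst0 -mpolyC1; exact: pspace_const.
- by apply: lspan_mem; exists 1%N; apply/prod_spaceP.
- exact: lspanD.
- apply: lspanM Hg Hh => a b [d Ha] [e Hb]; exists (d + e)%N.
  by rewrite -mconstD; apply: pspaceM.
Qed.

Local Notation comp d := (pihomog (@mdeg n) (m * d)).

Lemma comp_pspace d e g : pspace W (mconst m e) g -> comp d g = if d == e then g else 0.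
Proof.
move=> /pspace_homog; rewrite mdeg_mconst => hg; case: eqVneq => [->|de].
  exact: pihomog_dE.
(* As m > 0, distinct d and e give distinct degrees m d and m e. *)
apply: pihomog_ne0 hg; first by rewrite eqn_pmul2l // eq_sym.
Qed.

Local Notation A := (prod_alg V).
Local Notation vl := (val : A -> {mpoly K[n]}).

Lemma val_lspan (x : A) : lspan (fun z => exists d, pspace W (mconst m d) z) (vl x).
Proof. by apply: gen_subalg_lspan; have := valP x; rewrite /= => /asboolP. Qed.

Lemma comp_val d (x : A) : pspace W (mconst m d) (comp d (vl x)).
Proof.
elim/lspan_elim: (val_lspan x) => [|c z [e Hz]|y z Hy Hz].
- by rewrite linear0; apply: pspace_zero.
- rewrite linearZ /=; apply: pspaceZ; rewrite (comp_pspace d Hz).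
  by case: eqP => [->|_] //; apply: pspace_zero.
- by rewrite linearD; apply: pspace_add.
Qed.

Lemma val_sum_comp (x : A) : exists N, forall M, (N <= M)%N ->
  vl x = \sum_(d < M) comp d (vl x).
Proof.
elim/lspan_elim: (val_lspan x) => [|c z [e Hz]|y z [N HN] [M HM]].
- by exists 0%N => M _; rewrite big1 // => i _; rewrite linear0.
- exists e.+1 => M eM; rewrite (bigD1 (Ordinal eM)) //= linearZ /=.
  rewrite (comp_pspace e Hz) eqxx big1 ?addr0 // => i /negP ie.
  rewrite linearZ /= (comp_pspace i Hz); case: eqP => [Ei|]; last by rewrite scaler0.
  by case: ie; apply/eqP/val_inj.
- exists (maxn N M) => L; rewrite geq_max => /andP[NL ML].
  rewrite {1}(HN L NL) {1}(HM L ML) -big_split; apply: eq_bigr => i _.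
  by rewrite linearD.
Qed.

(** An element of A(V) is a sum of elements of the spaces V^(e,...,e), so its part of degree m d
    comes from e = d alone. *)
Lemma gr_pspace d (x : A) : prod_alg_gr d x <-> pspace W (mconst m d) (vl x).
Proof.
split=> [hx|/pspace_homog]; last by rewrite mdeg_mconst.
by have := comp_val d x; rewrite pihomog_dE.
Qed.

Lemma pspace_lift d g : pspace W (mconst m d) g -> exists2 x : A, vl x = g & prod_alg_gr d x.
Proof.
move=> Hg; have gA : g \in prod_alg_pred V by apply/asboolP/pspace_gen_subalg/Hg.
by exists (ProdAlg gA) => //; apply/gr_pspace.
Qed.

Lemma val_scale c (x : A) : vl (c *: x) = c *: vl x.
Proof. exact: linearZ. Qed.

Lemma val_mul (x y : A) : vl (x * y) = vl x * vl y.
Proof. exact: rmorphM. Qed.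

Lemma val_alg c : vl c%:A = c%:MP.
Proof.
by rewrite val_scale rmorph1 alg_mpolyC.
Qed.

Lemma prod_alg_standard_graded : standard_graded (@prod_alg_gr K n m V).
Proof.
split.
- move=> d; split; first exact: rpred0.
  by move=> c x y hx hy; apply: rpredD; [apply: rpredZ|].
- move=> x; have [N HN] := val_sum_comp x.
  have /choice[u Hu] d : exists y : A, vl y = comp d (vl x) /\ prod_alg_gr d y.
    by have [y Ey Hy] := pspace_lift (comp_val d x); exists y.
  exists N, u; split=> [d|]; first by case: (Hu d).
  apply: val_inj; rewrite (HN N) // raddf_sum; apply: eq_bigr => d _.
  by case: (Hu d).
- move=> N u Hu u0 d dN; apply: val_inj.
  have := congr1 (fun x : A => comp d (vl x)) u0; rewrite raddf0 linear0 => <-.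
  rewrite !raddf_sum (bigD1 (Ordinal dN)) //= big1 => [|i /negP id].
    by rewrite addr0 (comp_pspace d ((gr_pspace _ _).1 (Hu d))) eqxx.
  rewrite (comp_pspace d ((gr_pspace _ _).1 (Hu i))); case: eqP => // Ed.
  by case: id; apply/eqP/val_inj.
- move=> x; split=> [/gr_pspace|[c ->]]; last first.
    by apply/gr_pspace; rewrite mconst0 val_alg; apply: pspace_const.
  rewrite mconst0 => /pspace0_const[c Ec]; exists c; apply: val_inj.
  by rewrite val_alg.
- have [|||r [C [PC gen _]]] := @homog_rows_basis K n 1 (m * 1)
      (fun x => pspace W (mconst m 1) (x 0 0)).
  + by rewrite mxE; apply: pspace_zero.
  + by move=> c x y Hx Hy; rewrite !mxE mul_mpolyC; apply/pspace_add/Hy/pspaceZ.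
  + by move=> x Hx k; rewrite ord1 -mdeg_mconst; apply: pspace_homog Hx.
  have /fin_all_exists2[s Es Hs] i := pspace_lift (PC i).
  exists (codom s) => x; split=> [/gr_pspace Hx|].
    have [|w Ew] := gen (const_mx (vl x)); first by rewrite mxE.
    exists r, (fun i => w 0 i), s; split=> [l|]; first exact: codom_f.
    apply: val_inj; rewrite raddf_sum.
    have := congr1 (fun y : 'rV_1 => y 0 0) Ew; rewrite !mxE => ->.
    by apply: eq_bigr => i _; rewrite [RHS]val_scale Es !mxE mul_mpolyC.
  move=> Hx; apply/gr_pspace; elim/lspan_elim: Hx => [|c z /codomP[i ->]|y z Hy Hz].
  + by rewrite raddf0; apply: pspace_zero.
  + by rewrite val_scale; apply/pspaceZ/gr_pspace/Hs.
  + by rewrite raddfD; apply: pspace_add.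
- move=> i j x; split=> [/gr_pspace|Hx]; last first.
    apply/gr_pspace; elim/lspan_elim: Hx => [|c z [a [b [Ha Hb ->]]]|y z Hy Hz].
    + by rewrite raddf0; apply: pspace_zero.
    + rewrite val_scale val_mul -mconstD; apply/pspaceZ/pspaceM; exact/gr_pspace.
    + by rewrite raddfD; apply: pspace_add.
  rewrite -mconstD => /pspace_split [k [c [u [Hu Ex]]]].
  have /fin_all_exists2[z Ez Hz] (l : 'I_k) : exists2 z : A, vl z = u l &
      exists a b, [/\ prod_alg_gr i a, prod_alg_gr j b & z = a * b].
    have [a [b [Ha Hb Eu]]] := Hu l.
    have [a' Ea Ha'] := pspace_lift Ha; have [b' Eb Hb'] := pspace_lift Hb.
    exists (a' * b'); first by rewrite val_mul Ea Eb Eu.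
    by exists a', b'.
  exists k, c, z; split=> //; apply: val_inj; rewrite [LHS]Ex raddf_sum.
  by apply: eq_bigr => l _; rewrite [RHS]val_scale Ez.
Qed.

Local Notation SG := prod_alg_standard_graded.
Local Notation chain_in i := (projT2 (projT2 (chain W i))).

Lemma prow_lift d p (w : 'rV[{mpoly K[n]}]_p) :
  prow W (mconst m d) w -> exists y : 'rV[A]_p, map_mx vl y = w.
Proof.
move=> Hw; have /fin_all_exists[y Hy] k : exists y : A, vl y = w 0 k.
  by have [y Ey _] := pspace_lift (Hw k); exists y.
by exists (\row_k y k); apply/rowP => k; rewrite !mxE Hy.
Qed.

Lemma chain_lift i : exists D : 'M[A]_(chain_rk W i.+1, chain_rk W i),
  map_mx vl D = chain_mx W i.
Proof.
have /fin_all_exists[y Hy] k : exists y, map_mx vl y = row k (chain_mx W i).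
  by apply: (prow_lift (d := 1)) => l; rewrite mxE; apply: chain_mx_entry.
by exists (\matrix_k y k); apply/row_matrixP => k; rewrite -map_row rowK Hy.
Qed.

Definition res_mx i := projT1 (cid (chain_lift i)).

Lemma val_res_mx i : map_mx vl (res_mx i) = chain_mx W i.
Proof. by rewrite /res_mx; case: (cid _). Qed.

Lemma val_mx_inj p q : injective (fun x : 'M[A]_(p, q) => map_mx vl x).
Proof.
by move=> x y /matrixP Exy; apply/matrixP => k l; apply: val_inj; have := Exy k l; rewrite !mxE.
Qed.

Lemma chain_in_homog i k l : chain_in i k l \is (m * 1).-homog.
Proof.
case: i k l => [|i] k l; first by case: l.
by rewrite -mdeg_mconst; apply: pspace_homog (chain_mx_entry _ _).
Qed.

Lemma comp_chain_in i d (x : 'rV[A]_(chain_rk W i)) :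
  map_mx vl x *m chain_in i = 0 -> \row_k comp d (vl (x 0 k)) *m chain_in i = 0.
Proof.
move=> /rowP x0; apply/rowP => l; have := congr1 (pihomog (@mdeg n) (m * 1 + m * d)) (x0 l).
rewrite !mxE linear0 raddf_sum /= => E; rewrite -[RHS]E; apply: eq_bigr => k _.
by rewrite !mxE mulrC [in RHS]mulrC pihomogMl //; apply: chain_in_homog.
Qed.

(** The components of positive degree are lifted one at a time and summed; one of degree 0 could not
    be lifted, since the next map raises degrees. *)
Lemma chain_exact_row i (x : 'rV[A]_(chain_rk W i)) :
  map_mx vl x *m chain_in i = 0 -> (forall k, comp 0 (vl (x 0 k)) = 0) ->
  exists w, x = w *m res_mx i.
Proof.
move=> xC x0.
have /choice[y Hy] d : exists y : 'rV[A]_(chain_rk W i.+1),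
    \row_k comp d.+1 (vl (x 0 k)) = map_mx vl y *m chain_mx W i.
  have Hp : prow W (mconst m d.+1) (\row_k comp d.+1 (vl (x 0 k))).
    by move=> k; rewrite mxE; apply: comp_val.
  have [w Hw ->] := chain_exact m_gt0 Hp (comp_chain_in d.+1 xC).
  by have [y <-] := prow_lift Hw; exists y.
have /fin_all_exists[N HN] k := val_sum_comp (x 0 k).
exists (\sum_(d < \max_k N k) y d); apply: val_mx_inj; rewrite map_mxM val_res_mx.
rewrite map_mx_sum mulmx_suml; apply/rowP => k.
rewrite mxE (HN k _ (leqW (leq_bigmax k))) big_ord_recl x0 add0r summxE.
by apply: eq_bigr => d _; rewrite -Hy mxE.
Qed.

Lemma res_mx_comp i : res_mx i.+1 *m res_mx i = 0.
Proof.
apply: val_mx_inj; rewrite map_mxM !val_res_mx map_mx0.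
exact: (chain_mx_comp W i.+1).
Qed.

Lemma res_mx_gr i k l : prod_alg_gr 1 (res_mx i k l).
Proof.
apply/gr_pspace.
have := congr1 (fun X : 'M_(_, _) => X k l) (val_res_mx i); rewrite mxE => ->.
exact: chain_mx_entry.
Qed.

Lemma irrelevant_comp0 (x : A) : irrelevant (@prod_alg_gr K n m V) x -> comp 0 (vl x) = 0.
Proof.
elim/lspan_elim => [|c z [d d0 Hd]|y z Hy Hz]; first by rewrite !linear0.
  rewrite val_scale linearZ /= (comp_pspace 0 ((gr_pspace _ _).1 Hd)).
  by rewrite eq_sym gtn_eqF // scaler0.
by rewrite !raddfD /= Hy Hz addr0.
Qed.

Definition linear_resolution : free_complex A :=
  @FreeComplex K A (chain_rk W) (fun i _ => i%:Z) res_mx (const_mx 1).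

Lemma linear_resolutionP : is_resolution (@prod_alg_gr K n m V) linear_resolution.
Proof.
have augE (v : 'rV[A]_1) : (v *m (const_mx 1 : 'cV[A]_1)) 0 0 = v 0 0.
  by rewrite mxE big_ord1 mxE mulr1.
split.
- move=> i k l; rewrite /= (_ : i.+1%:Z - i%:Z = 1); first exact: res_mx_gr.
  by rewrite -addn1 PoszD addrC addKr.
- by move=> k l; rewrite subrr mxE; apply: (gr0_1 SG).
- exists (const_mx 1); apply/(irrelevantP SG).
  by rewrite [X in X - 1](augE (const_mx 1)) mxE subrr gcomp0.
- move=> v; have Ev : (v *m augm linear_resolution) 0 0 = v 0 (0 : 'I_1) := augE v.
  rewrite Ev; split=> [v0|[w ->]].
    apply: (@chain_exact_row 0); first by apply/matrixP => ? [].
    by move=> k; rewrite (ord1 k); apply: irrelevant_comp0.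
  apply/(irrelevantP SG); rewrite mxE gcomp_bigsum big1 // => k _.
  by rewrite gcomp0M (gcomp_hom SG 0 (res_mx_gr _ _)) mulr0.
- move=> i v; split=> [v0|[w ->]]; last by rewrite -mulmxA res_mx_comp mulmx0.
  have vC : map_mx vl v *m chain_in i.+1 = 0.
    by rewrite -[chain_in i.+1]val_res_mx -map_mxM v0 map_mx0.
  apply: chain_exact_row => // k.
  (* The degree-zero component is a constant row in the kernel; it vanishes because the rows of the
     preceding kernel basis are independent over K. *)
  have /fin_all_exists[c Hc] l : exists c, comp 0 (vl (v 0 l)) = c%:MP.
    by apply: (@pspace0_const _ _ _ W); rewrite -(mconst0 m); apply: comp_val.
  have := comp_chain_in 0 vC.
  rewrite (_ : \row_k _ = map_mx (@mpolyC n K) (\row_l c l)); last first.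
    by apply/rowP => l; rewrite !mxE Hc.
  move=> /(chain_mx_free (i := i)) /rowP /(_ k); rewrite !mxE Hc => ->.
  exact: mpolyC0.
Qed.

Lemma prod_alg_Koszul : Koszul (@prod_alg_gr K n m V).
Proof. exact: (Koszul_linear_resolution SG linear_resolutionP). Qed.

End ProductAlgebraKoszul.

Theorem theorem3p19 (K : fieldType) (n m : nat) (m_gt0 : (0 < m)%N)
    (V : 'I_m -> submodClosed {mpoly K[n]})
    (V_linear : forall (i : 'I_m) (f : {mpoly K[n]}), f \in V i -> f \is 1.-homog) :
  Koszul (@prod_alg_gr K n m V).
Proof. exact: prod_alg_Koszul. Qed.
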